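(* Let $A$ be a finitely generated standard graded algebra over a field $k$ with $\dim A>0$, and let $I$ be an ideal of $A$ generated by homogeneous elements of the same degree $d\ge 1$. Let $x_1,\dots,x_s$ be a superficial sequence of $I$ consisting of homogeneous elements of $I$ such that $J=(x_1,\dots,x_s)$ is a reduction of $I$. Then $\operatorname{reg}F(I)$ equals the least integer $t\ge r_J(I)$ such that $$\big(I^{n+1}\cap[(x_1,\dots,x_{i-1}):x_i]\big)_{(n+1)d}=\big((x_1,\dots,x_{i-1})I^n\big)_{(n+1)d}$$ for all $n\ge t$ and all $i=1,\dots,s$.
   Context: For a graded module $M$, $M_j$ denotes its component of degree $j$. An element $x\in I$ is superficial for $I$ if there is an integer $c$ such that $(I^{n+1}:x)\cap I^c=I^n$ for all large $n$. A system $x_1,\dots,x_s$ of elements of $I$ is a superficial sequence of $I$ if the image of $x_i$ is a superficial element for the image of $I$ in $A/(x_1,\dots,x_{i-1})$, for $i=1,\dots,s$. An ideal $J\subseteq I$ is a reduction of $I$ if $I^{n+1}=JI^n$ for some $n\ge 0$; the least such $n$ is the reduction number $r_J(I)$. $F(I)=\bigoplus_{n\ge 0}I^n/\mathfrak mI^n$ is the fiber ring of $I$, where $\mathfrak m$ is the maximal graded ideal of $A$; it is a standard graded $k$-algebra, isomorphic to the subalgebra $k[I_d]$ of $A$ (with $(I^n)_{nd}$ in degree $n$). For a standard graded algebra $R$ over a commutative ring, with $R_+$ the ideal generated by elements of positive degree, put $a_i(R)=\max\{n\mid H^i_{R_+}(R)_n\ne 0\}$ ($-\infty$ if $H^i_{R_+}(R)=0$)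 and $\operatorname{reg}R=\max\{a_i(R)+i\mid i\ge 0\}$. *)

(* Defs.v *)
From HB Require Import structures.
From mathcomp Require Import all_boot all_order all_algebra.
From mathcomp Require Import generic_quotient ring_quotient.
From mathcomp Require Import boolp classical_sets.

Set Implicit Arguments.
Unset Strict Implicit.
Unset Printing Implicit Defensive.

Import GRing.Theory.
Local Open Scope classical_set_scope.
Local Open Scope ring_scope.
Local Open Scope quotient_scope.

Section Ideals.
Variable R : comPzRingType.
Implicit Types (I J K S : set R) (x : R).

Definition is_ideal K : Prop :=
  [/\ K 0, forall x y, K x -> K y -> K (x + y) & forall a x, K x -> K (a * x)].

Definition ideal_gen S : set R := smallest is_ideal S.

Definition ideal_mul I J : set R := ideal_gen [set a * b | a in I & b in J].

Fixpoint ideal_pow I n : set R :=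
  if n is n'.+1 then ideal_mul I (ideal_pow I n') else setT.

Definition ideal_colon K x : set R := [set a | K (a * x)].

Definition prime_ideal K : Prop :=
  [/\ is_ideal K, ~ K 1 & forall a b, K (a * b) -> K a \/ K b].

Definition krull_dim_ge (n : nat) : Prop :=
  exists P : nat -> set R, (forall i, (i <= n)%N -> prime_ideal (P i)) /\
    (forall i, (i < n)%N -> P i `<` P i.+1).

Definition is_reduction J I : Prop :=
  J `<=` I /\ exists n, ideal_pow I n.+1 = ideal_mul J (ideal_pow I n).

End Ideals.

Arguments krull_dim_ge : clear implicits.

Definition is_least (P : nat -> Prop) (m : nat) : Prop :=
  P m /\ forall n, P n -> (m <= n)%N.

Definition is_max (E : set int) (m : int) : Prop :=
  E m /\ forall n, E n -> n <= m.

Definition is_reduction_number (R : comPzRingType) (J I : set R) : nat -> Prop :=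
  is_least (fun n => ideal_pow I n.+1 = ideal_mul J (ideal_pow I n)).

Section IdealTheory.
Variable R : comPzRingType.
Implicit Types (I J K S : set R) (x : R).

Lemma ideal_gen_ideal S : is_ideal (ideal_gen S).
Proof.
split=> [K [[]] //|x y Kx Ky K KS|a x Kx K KS].
  by case: (KS) => -[_ KD _] _; apply: KD; [apply: Kx | apply: Ky].
by case: (KS) => -[_ _ KM] _; apply: KM; apply: Kx.
Qed.

Lemma sub_ideal_gen S : S `<=` ideal_gen S.
Proof. by move=> x Sx K [_]; apply. Qed.

Lemma ideal_pow_ideal I n : is_ideal (ideal_pow I n).
Proof. by case: n => [|n]; [split | apply: ideal_gen_ideal]. Qed.

Lemma ideal_mul_closed I m n a b :
  ideal_pow I m a -> ideal_pow I n b -> ideal_pow I (m + n) (a * b).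
Proof.
move=> Ia Ib; elim: m a Ia => [|m IHm] a Ia.
  by case: (ideal_pow_ideal I n) => _ _; apply.
have [I0 ID IM] := ideal_pow_ideal I (m.+1 + n).
apply: (Ia [set c | ideal_pow I (m.+1 + n) (c * b)]); split; first split.
- by rewrite /= mul0r.
- by move=> x y /= Ix Iy; rewrite mulrDl; apply: ID.
- by move=> c x /= Ix; rewrite -mulrA; apply: IM.
move=> _ [x Ix [y Iy <-]] /=; rewrite -mulrA; apply: sub_ideal_gen.
by exists x => //; exists (y * b) => //; apply: IHm.
Qed.

End IdealTheory.

(* Quotient by the ideal generated by an arbitrary subset; the zero ring is
   allowed, whence a comPzRingType and not the {ideal_quot _} ring structure. *)
Section QuotientRing.
Variables (R : comPzRingType) (S : set R).

Definition ideal_mem : {pred R} := fun x => `[< ideal_gen S x >].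

Lemma ideal_mem_zmod_closed : zmod_closed ideal_mem.
Proof.
have [I0 ID IM] := ideal_gen_ideal S; split; first exact/asboolP.
move=> x y /asboolP Ix /asboolP Iy; apply/asboolP.
by apply: ID => //; rewrite -mulN1r; apply: IM.
Qed.

HB.instance Definition _ :=
  GRing.isZmodClosed.Build R ideal_mem ideal_mem_zmod_closed.

Definition quot_ring : Type := Quotient.quot ideal_mem.

HB.instance Definition _ := GRing.Zmodule.on quot_ring.

Definition to_quot (x : R) : quot_ring := \pi_(Quotient.quot ideal_mem) x.

Definition quot_mul (x y : quot_ring) : quot_ring := to_quot
  (repr (x : Quotient.quot ideal_mem) * repr (y : Quotient.quot ideal_mem)).

Lemma ideal_memMl a x : x \in ideal_mem -> a * x \in ideal_mem.
Proof.
have [_ _ IM] := ideal_gen_ideal S.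
by move=> /asboolP Ix; apply/asboolP; apply: IM.
Qed.

Lemma to_quot_eq x y : to_quot x = to_quot y <-> ideal_gen S (x - y).
Proof.
rewrite /to_quot; split=> [/eqP|Ixy].
  by rewrite -Quotient.idealrBE => /asboolP.
by apply/eqP; rewrite -Quotient.idealrBE; apply/asboolP.
Qed.

Lemma to_quot_surj (x : quot_ring) : exists a, x = to_quot a.
Proof. by exists (repr (x : Quotient.quot ideal_mem)); rewrite /to_quot reprK. Qed.

Lemma to_quotD : {morph to_quot : x y / x + y}.
Proof. by move=> x y; rewrite /to_quot raddfD. Qed.

Lemma to_quotM x y : quot_mul (to_quot x) (to_quot y) = to_quot (x * y).
Proof.
have E z : repr (to_quot z : Quotient.quot ideal_mem) - z \in ideal_mem.
  by apply/asboolP/to_quot_eq; rewrite /to_quot reprK.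
apply/to_quot_eq/asboolP; set x' := repr _; set y' := repr _.
rewrite -[`[< _ >]]/(x' * y' - x * y \in ideal_mem).
have -> : x' * y' - x * y = y' * (x' - x) + x * (y' - y).
  by rewrite !mulrBr addrA [y' * x']mulrC [y' * x]mulrC subrK.
by apply: rpredD; apply: ideal_memMl; exact: E.
Qed.

Fact quot_mulA : associative quot_mul.
Proof.
move=> x y z; have [a ->] := to_quot_surj x; have [b ->] := to_quot_surj y.
by have [c ->] := to_quot_surj z; rewrite !to_quotM mulrA.
Qed.

Fact quot_mulC : commutative quot_mul.
Proof. by move=> x y; rewrite /quot_mul mulrC. Qed.

Fact quot_mul1 : left_id (to_quot 1) quot_mul.
Proof. by move=> x; have [a ->] := to_quot_surj x; rewrite to_quotM mul1r. Qed.

Fact quot_mulDl : left_distributive quot_mul +%R.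
Proof.
move=> x y z; have [a ->] := to_quot_surj x; have [b ->] := to_quot_surj y.
have [c ->] := to_quot_surj z.
by rewrite -to_quotD !to_quotM -to_quotD mulrDl.
Qed.

HB.instance Definition _ := GRing.Zmodule_isComPzRing.Build quot_ring
  quot_mulA quot_mulC quot_mul1 quot_mulDl.

End QuotientRing.

Section Superficial.
Variable R : comPzRingType.

Definition superficial (I : set R) (x : R) : Prop :=
  I x /\ exists c N, forall n, (N <= n)%N ->
    ideal_colon (ideal_pow I n.+1) x `&` ideal_pow I c = ideal_pow I n.

Definition ideal_before (s : nat) (x : 'I_s -> R) (i : 'I_s) : set R :=
  ideal_gen [set x j | j in [set j : 'I_s | (j < i)%N]].

End Superficial.

Definition superficial_seq (R : comPzRingType) (I : set R) (s : nat)
    (x : 'I_s -> R) : Prop :=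
  forall i, I (x i) /\
    superficial (@to_quot R (ideal_before x i) @` I)
                (to_quot (ideal_before x i) (x i)).

Section GradedRings.
Variable R : comPzRingType.

Record grading (gr : nat -> set R) : Prop := Grading {
  gr0 : forall n, gr n 0;
  grB : forall n x y, gr n x -> gr n y -> gr n (x - y);
  gr1 : gr 0%N 1;
  grM : forall m n x y, gr m x -> gr n y -> gr (m + n)%N (x * y);
  gr_span : forall x, exists n (u : nat -> R),
    (forall i, gr i (u i)) /\ x = \sum_(i < n) u i;
  gr_direct : forall n (u : nat -> R), (forall i, gr i (u i)) ->
    \sum_(i < n) u i = 0 -> forall i, (i < n)%N -> u i = 0
}.

Variable gr : nat -> set R.

Definition irrelevant_ideal : set R := ideal_gen (\bigcup_(n in [set n | (0 < n)%N]) gr n).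

Definition gr_int (n : int) : set R := if n is Posz n' then gr n' else [set 0].

End GradedRings.

Definition standard_graded (k : fieldType) (A : comAlgType k)
    (gr : nat -> set A) : Prop :=
  [/\ grading gr, gr 0%N = [set c%:A | c in [set: k]] &
      exists r (g : 'I_r -> A), (forall j, gr 1%N (g j)) /\
        forall B : set A, (forall c : k, B c%:A) ->
          (forall a b, B a -> B b -> B (a + b)) ->
          (forall a b, B a -> B b -> B (a * b)) ->
          (forall j, B (g j)) -> B = setT].

(* Local cohomology H^p_{R_+}(R) of a graded ring, computed by the Cech complex
   C^p = \bigoplus_{#|S| = p} R_{y_S}, y_S = \prod_{j in S} y_j, of a finite
   sequence y of elements of degree 1 generating R_+.  A cochain of degree p is
   given by numerators u S over a common exponent e : its component at S is
   u S / y_S ^ e, which has degree n when u S has degree n + e * p. *)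
Section CechCohomology.
Variables (R : comPzRingType) (gr : nat -> set R) (r : nat) (y : 'I_r -> R).
Implicit Types (S T : {set 'I_r}) (u v : {set 'I_r} -> R) (n : int).

Definition yprod S : R := \prod_(j in S) y j.

(* a / y_S ^ e = b / y_S ^ f in the localization R_{y_S} *)
Definition frac_eq S (a : R) (e : nat) (b : R) (f : nat) : Prop :=
  exists c : nat, yprod S ^+ c * (yprod S ^+ f * a - yprod S ^+ e * b) = 0.

Definition cech_cochain p n (e : nat) u : Prop :=
  forall S, #|S| = p -> gr_int gr (n + (e * p)%N%:Z) (u S).

(* numerator over y_T ^ e of the Cech differential; the restriction
   R_{y_(T \ t)} -> R_{y_T} sends a / y_(T \ t) ^ e to y_t ^ e * a / y_T ^ e *)
Definition cech_diff (e : nat) u T : R :=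
  \sum_(t in T) (-1) ^+ #|[set s in T | (s < t)%N]| * (y t ^+ e * u (T :\ t)).

Definition cech_cocycle p n e u : Prop :=
  cech_cochain p n e u /\
  forall T, #|T| = p.+1 -> frac_eq T (cech_diff e u T) e 0 0.

(* For p = 0 there is no condition on v and cech_diff f v finset.set0 = 0. *)
Definition cech_coboundary p n e u : Prop :=
  exists (f : nat) v,
    (forall q, q.+1 = p -> cech_cochain q n f v) /\
    forall T, #|T| = p -> frac_eq T (u T) e (cech_diff f v T) f.

Definition cech_nonzero p n : Prop :=
  exists e u, cech_cocycle p n e u /\ ~ cech_coboundary p n e u.

End CechCohomology.

Section Regularity.
Variables (R : comPzRingType) (gr : nat -> set R).

(* H^p_{R_+}(R)_n <> 0 (independent of the generating sequence y) *)
Definition loc_coh_nonzero (p : nat) : set int :=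
  [set n | exists r (y : 'I_r -> R),
    [/\ forall j, gr 1%N (y j), ideal_gen (range y) = irrelevant_ideal gr
      & cech_nonzero gr y p n]].

(* a_p(R), with None standing for -oo *)
Definition is_a_invariant (p : nat) (a : option int) : Prop :=
  if a is Some m then is_max (loc_coh_nonzero p) m
  else loc_coh_nonzero p = set0.

Definition is_reg (rho : int) : Prop :=
  (forall p, exists a, is_a_invariant p a) /\
  is_max [set m | exists p a, is_a_invariant p (Some a) /\ m = a + p%:Z] rho.

End Regularity.

(* Rees algebra A[It], as a subring of the polynomial ring A[t]. *)
Section ReesAlgebra.
Variables (A : comNzRingType) (I : set A).

Definition rees_mem : {pred {poly A}} :=
  fun p => `[< forall n, ideal_pow I n p`_n >].

Lemma rees_subring_closed : subring_closed rees_mem.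
Proof.
have II := ideal_pow_ideal I.
have IN n x : ideal_pow I n x -> ideal_pow I n (- x).
  by case: (II n) => _ _ IM Ix; rewrite -mulN1r; apply: IM.
have ID n x y : ideal_pow I n x -> ideal_pow I n y -> ideal_pow I n (x + y).
  by case: (II n) => _ ID _; apply: ID.
have I0 n : ideal_pow I n 0 by case: (II n).
split.
- by apply/asboolP => -[|n] //; rewrite coef1.
- move=> p q /asboolP Ip /asboolP Iq; apply/asboolP => n.
  by rewrite coefB; apply: ID => //; apply: IN.
move=> p q /asboolP Ip /asboolP Iq; apply/asboolP => n; rewrite coefM.
apply: (big_ind (ideal_pow I n)) => [||i _]; [exact: I0 | exact: ID |].
by rewrite -{1}(subnKC (leq_ord i)); apply: ideal_mul_closed.
Qed.

HB.instance Definition _ :=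
  GRing.isSubringClosed.Build {poly A} rees_mem rees_subring_closed.

Record rees : Type := Rees { rees_val : {poly A}; _ : rees_val \in rees_mem }.

HB.instance Definition _ := [isSub for rees_val].
HB.instance Definition _ := [Choice of rees by <:].
HB.instance Definition _ := [SubChoice_isSubComNzRing of rees by <:].

End ReesAlgebra.

(* F(I) = \bigoplus_n I^n / m I^n, as the quotient of A[It] = \bigoplus_n I^n t^n
   by the ideal \bigoplus_n m I^n t^n, for m the irrelevant ideal of A. *)
Section FiberRing.
Variables (A : comNzRingType) (gr : nat -> set A) (I : set A).

Definition fiber_ideal : set (rees I) :=
  [set p | forall n,
    ideal_mul (irrelevant_ideal gr) (ideal_pow I n) (rees_val p)`_n].

Lemma fiber_ideal_ideal : is_ideal fiber_ideal.
Proof.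
set m := irrelevant_ideal gr.
have mI n : is_ideal (ideal_mul m (ideal_pow I n)) by apply: ideal_gen_ideal.
split=> [n|p q Ip Iq n|q p Ip n].
- by rewrite coef0; case: (mI n).
- by rewrite coefD; case: (mI n) => _ mD _; apply: mD.
rewrite coefM; have [m0 mD _] := mI n.
apply: (big_ind (ideal_mul m (ideal_pow I n))) => // i _.
have /asboolP/(_ i) Iqi := valP q.
have leqin := leq_ord i.
apply: (Ip (n - i)%N
  [set c | ideal_mul m (ideal_pow I n) ((rees_val q)`_i * c)]).
split; first split.
- by rewrite /= mulr0.
- by move=> x y /= mx my; rewrite mulrDr; apply: mD.
- by move=> a x /= mx; rewrite mulrCA; case: (mI n) => _ _; apply.
move=> _ [x mx [y Iy <-]] /=; rewrite mulrCA; apply: sub_ideal_gen.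
exists x => //; exists ((rees_val q)`_i * y) => //.
by have := ideal_mul_closed Iqi Iy; rewrite subnKC.
Qed.

Definition fiber_ring : Type := quot_ring fiber_ideal.

HB.instance Definition _ := GRing.ComPzRing.on fiber_ring.

Definition fiber_gr (n : nat) : set fiber_ring :=
  to_quot fiber_ideal @`
    [set p : rees I | forall i, i != n -> (rees_val p)`_i = 0].

End FiberRing.

Arguments fiber_ideal {A} gr I _.
Arguments fiber_gr {A} gr I n _.

(* Main.v *)
Require Import Defs.
From mathcomp Require Import all_boot all_order all_algebra.
From mathcomp Require Import boolp classical_sets.
From mathcomp Require Import ring zify.

Set Implicit Arguments.
Unset Strict Implicit.
Unset Printing Implicit Defensive.

Import Order.TTheory GRing.Theory.
Local Open Scope classical_set_scope.
Local Open Scope ring_scope.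

(** The degree [n] part of [F = F(I)] is identified with [E n], the degree [n d] part of
    [I ^ n], so that [F] is the subalgebra [k[I_d]] of [A] ([fiber_gr_piece],
    [fiber_piece_class_eq0]). The [x_i] of degree [d] are then linear forms [z_i] of [F], and
    the other ones become zero in [F].

    The regularity of a standard graded ring [R] can be read off linear forms [z_i] such
    that each [z_i] is a nonzerodivisor modulo the previous ones in high degrees and the
    [z_i] generate [R] in high degrees: it is the least [t] such that both hold in all
    degrees greater than [t] ([reg_filter_regular]). One divides by one [z_i] at a time
    and follows the vanishing of local cohomology along the exact sequence of
    multiplication by [z_i], in both directions ([cech_acyclic_down] and
    [cech_acyclic_up]). The Cech complex is the direct limit over [e] of the Koszul
    complexes of the [y_j ^ e]. Working in these complexes replaces fractions by exact
    congruences, and the Koszul homotopies show that powers of [z_i] kill cohomology.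

    It remains to compare conditions. In [F] they concern the products [a z_i] in
    [(z_j : j < i) F], in the theorem the products [a x_i] in the larger ideal
    [(x_j : j < i)] of [A]. The two ideals agree in high degrees: [k[I_d]] is Noetherian, which
    yields an Artin-Rees lemma ([artin_rees]), and with it superficiality gives the colon
    condition of the theorem in high degrees ([colon_large]). From there it descends to
    every degree greater than [t], by multiplication with the forms [x_j] of degree [d]
    with [j >= i] ([regular_colon_condition]). The converse implication is immediate. The
    condition [r_J(I) <= t] says that the [z_i] generate [F] in degrees greater than [t]
    ([reduction_number_le]). *)

(** * Bounds and ideals *)

Lemma uniform_bound (T : finType) (P : T -> nat -> Prop) :
  (forall x c c', (c <= c')%N -> P x c -> P x c') ->
  (forall x, exists c, P x c) -> exists c, forall x, P x c.
Proof.
move=> Pmono /choice[f Pf]; exists (\max_x f x)%N => x.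
by apply: Pmono (Pf x); apply: leq_bigmax.
Qed.

Lemma int_set_max (E : set int) (b : int) : E !=set0 ->
  (forall n, E n -> n <= b) -> exists m, is_max E m.
Proof.
move=> [n0 En0] Eb.
have [|k /asboolP Ek kmin] := @ex_minnP (fun k : nat => `[< E (b - k%:Z) >]).
  exists (absz (b - n0)); apply/asboolP; have := Eb _ En0 => h.
  by rewrite (_ : b - _ = n0) //; lia.
exists (b - k%:Z); split=> // n En; have nb := Eb n En.
have := kmin (absz (b - n)); rewrite (_ : b - (absz _)%:Z = n); last by lia.
by move=> /(_ (asboolT En)); lia.
Qed.

Section IdealBasics.
Variable R : comPzRingType.
Implicit Types (K L S : set R) (a b z : R).

Lemma ideal0 K : is_ideal K -> K 0.
Proof. by case. Qed.

Lemma idealD K a b : is_ideal K -> K a -> K b -> K (a + b).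
Proof. by case=> _ KD _; apply: KD. Qed.

Lemma idealM K a b : is_ideal K -> K b -> K (a * b).
Proof. by case=> _ _ KM; apply: KM. Qed.

Lemma idealN K a : is_ideal K -> K a -> K (- a).
Proof. by move=> iK Ka; rewrite -mulN1r; apply: idealM. Qed.

Lemma idealB K a b : is_ideal K -> K a -> K b -> K (a - b).
Proof. by move=> iK Ka Kb; apply: idealD => //; apply: idealN. Qed.

Lemma ideal_sum K (T : Type) (r : seq T) (P : pred T) (F : T -> R) :
  is_ideal K -> (forall i, P i -> K (F i)) -> K (\sum_(i <- r | P i) F i).
Proof.
move=> iK KF; apply: big_ind => //; first exact: ideal0.
by move=> a b; apply: idealD.
Qed.

Lemma ideal_gen_min S K : is_ideal K -> S `<=` K -> ideal_gen S `<=` K.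
Proof. by move=> iK SK a; apply; split. Qed.

Lemma ideal_gen_id K : is_ideal K -> ideal_gen K = K.
Proof.
move=> iK; apply/seteqP; split; last exact: sub_ideal_gen.
exact: ideal_gen_min.
Qed.

Lemma ideal_genS S L : S `<=` L -> ideal_gen S `<=` ideal_gen L.
Proof.
move=> SL; apply: ideal_gen_min; first exact: ideal_gen_ideal.
by move=> a Sa; apply: sub_ideal_gen; apply: SL.
Qed.

Lemma ideal_mul_ideal K L : is_ideal (ideal_mul K L).
Proof. exact: ideal_gen_ideal. Qed.

Lemma ideal_mulP K L a b : K a -> L b -> ideal_mul K L (a * b).
Proof. by move=> Ka Lb; apply: sub_ideal_gen; exists a => //; exists b. Qed.

Lemma ideal_mul_min K L P :
  is_ideal P -> (forall a b, K a -> L b -> P (a * b)) -> ideal_mul K L `<=` P.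
Proof.
by move=> iP KLP; apply: ideal_gen_min => // _ [a Ka [b Lb <-]]; apply: KLP.
Qed.

Lemma ideal_mulS K K' L L' :
  K `<=` K' -> L `<=` L' -> ideal_mul K L `<=` ideal_mul K' L'.
Proof.
move=> sK sL; apply: ideal_mul_min; first exact: ideal_mul_ideal.
by move=> a b Ka Lb; apply: ideal_mulP; [apply: sK | apply: sL].
Qed.

Lemma ideal_mul_subr K L : is_ideal L -> ideal_mul K L `<=` L.
Proof. by move=> iL; apply: ideal_mul_min => // a b _ Lb; apply: idealM. Qed.

Lemma ideal_mul_subl K L : is_ideal K -> ideal_mul K L `<=` K.
Proof.
by move=> iK; apply: ideal_mul_min => // a b Ka _; rewrite mulrC; apply: idealM.
Qed.

Lemma ideal_powS_sub K n : ideal_pow K n.+1 `<=` ideal_pow K n.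
Proof. by apply: ideal_mul_subr; apply: ideal_pow_ideal. Qed.

Lemma ideal_pow_le K m n : (m <= n)%N -> ideal_pow K n `<=` ideal_pow K m.
Proof.
move=> mn; rewrite -(subnK mn); elim: (n - m)%N => [|l IHl] //.
by apply: subset_trans IHl; apply: ideal_powS_sub.
Qed.

Lemma ideal_gen_rangeP r (y : 'I_r -> R) a : ideal_gen (range y) a ->
  exists b : 'I_r -> R, a = \sum_j b j * y j.
Proof.
move: a; apply: ideal_gen_min.
  split=> [|a a' [b ->] [b' ->]|c a [b ->]].
  - by exists (fun=> 0); rewrite big1 // => j _; rewrite mul0r.
  - by exists (fun j => b j + b' j); rewrite -big_split; apply: eq_bigr => j _; rewrite mulrDl.
  by exists (fun j => c * b j); rewrite mulr_sumr; apply: eq_bigr => j _; rewrite mulrA.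
move=> _ [j _ <-]; exists (fun i => (i == j)%:R); rewrite (bigD1 j) //= eqxx mul1r.
by rewrite big1 ?addr0 // => i /negPf ->; rewrite mul0r.
Qed.

Lemma ideal_mul_rangeP r (y : 'I_r -> R) L a : is_ideal L ->
  ideal_mul (ideal_gen (range y)) L a ->
  exists b : 'I_r -> R, (forall j, L (b j)) /\ a = \sum_j y j * b j.
Proof.
move=> iP; move: a; apply: ideal_mul_min.
  split=> [|a a' [b [Pb ->]] [b' [Pb' ->]]|c a [b [Pb ->]]].
  - exists (fun=> 0); split=> [_|]; first exact: ideal0.
    by rewrite big1 // => j _; rewrite mulr0.
  - exists (fun j => b j + b' j); split=> [j|]; first exact: idealD.
    by rewrite -big_split; apply: eq_bigr => j _; rewrite mulrDr.
  exists (fun j => c * b j); split=> [j|]; first exact: idealM.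
  by rewrite mulr_sumr; apply: eq_bigr => j _; rewrite mulrCA.
move=> a b /ideal_gen_rangeP[c ->] Pb; exists (fun j => c j * b); split=> [j|].
  exact: idealM.
by rewrite mulr_suml; apply: eq_bigr => j _; rewrite mulrCA mulrA.
Qed.

(** Each term of the binomial expansion of [(a + b) ^ (N + M)] contains [a ^ N] or
    [b ^ M]. *)
Lemma pow_mem_ideal_sum (J : Type) (K : set R) (s : seq J) (F : J -> R) :
  is_ideal K -> (forall j, exists N, K (F j ^+ N)) ->
  exists N, K ((\sum_(j <- s) F j) ^+ N).
Proof.
move=> iK KF; apply: (big_ind (fun a => exists N, K (a ^+ N))) => //.
  by exists 1%N; rewrite expr1; apply: ideal0.
move=> a b [N KaN] [M KbM]; exists (N + M)%N; rewrite exprDn.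
apply: ideal_sum => // i _; rewrite -mulr_natl; apply: idealM => //.
have [iM|Mi] := leqP i M.
  by rewrite mulrC; apply: idealM => //; rewrite -addnBA // exprD mulrC; apply: idealM.
by apply: idealM => //; rewrite -(subnK (ltnW Mi)) exprD; apply: idealM.
Qed.

(** The cofactor of [z] in [K + zR] stays existentially quantified, so that it can
    later be chosen homogeneous. *)
Definition add_principal K z : set R := [set a | exists b, K (a - z * b)].

Lemma add_principal_ideal K z : is_ideal K -> is_ideal (add_principal K z).
Proof.
move=> iK; split.
- by exists 0; rewrite mulr0 subr0; apply: ideal0.
- move=> a b [a' Ka] [b' Kb]; exists (a' + b').
  by rewrite mulrDr opprD addrACA; apply: idealD.
move=> c a [a' Ka]; exists (c * a').
by rewrite mulrCA -mulrBr; apply: idealM.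
Qed.

Lemma sub_add_principal K z : K `<=` add_principal K z.
Proof. by move=> a Ka; exists 0; rewrite mulr0 subr0. Qed.

End IdealBasics.

(** * Homogeneous components *)

Section HomogeneousComponents.
Variables (R : comPzRingType) (gr : nat -> set R).
Hypothesis grP : grading gr.
Implicit Types (a b x z : R) (Q : set R).

Lemma gr_zero n : gr n 0. Proof. exact: gr0. Qed.

Lemma grN n a : gr n a -> gr n (- a).
Proof. by move=> ga; rewrite -sub0r; apply: (grB grP) => //; apply: gr_zero. Qed.

Lemma grD n a b : gr n a -> gr n b -> gr n (a + b).
Proof. by move=> ga gb; rewrite -(opprK b); apply: (grB grP) => //; apply: grN. Qed.

(** Requiring the tail to vanish makes [u] unique, unlike the finite sums of the
    definition of a grading. *)
Definition is_decomp x (u : nat -> R) : Prop :=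
  (forall i, gr i (u i)) /\
  exists N, (forall i, (N <= i)%N -> u i = 0) /\ x = \sum_(i < N) u i.

Lemma decomp_ex x : exists u, is_decomp x u.
Proof.
have [n [u [gu xE]]] := gr_span grP x.
exists (fun i => if (i < n)%N then u i else 0); split=> [i|].
  by case: ifP => // _; apply: gr_zero.
exists n; split=> [i ni|]; first by rewrite ltnNge ni.
by rewrite xE; apply: eq_bigr => i _; rewrite ltn_ord.
Qed.

Lemma sum_widen (u : nat -> R) N M : (N <= M)%N ->
  (forall i, (N <= i)%N -> u i = 0) -> \sum_(i < M) u i = \sum_(i < N) u i.
Proof.
move=> NM u0; rewrite (big_ord_widen _ u NM) [LHS](bigID (fun i : 'I_M => (i < N)%N)) /=.
by rewrite [X in _ + X]big1 ?addr0 // => i; rewrite -leqNgt => /u0.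
Qed.

Lemma decomp_uniq x u v : is_decomp x u -> is_decomp x v -> u = v.
Proof.
move=> [gu [N [u0 xu]]] [gv [M [v0 xv]]]; apply/funext => i.
pose L := maxn i.+1 (maxn N M).
have [iL NL ML] : [/\ (i < L)%N, (N <= L)%N & (M <= L)%N] by rewrite /L; split; lia.
apply/subr0_eq; apply: (gr_direct grP (n := L) (u := fun j => u j - v j)) => //.
  by move=> j; apply: (grB grP).
by rewrite sumrB (sum_widen NL u0) (sum_widen ML v0) -xu -xv subrr.
Qed.

Definition hcomp x : nat -> R := projT1 (cid (decomp_ex x)).

Lemma hcompP x : is_decomp x (hcomp x).
Proof. by rewrite /hcomp; case: (cid _). Qed.

Lemma hcomp_gr x i : gr i (hcomp x i).
Proof. by have [] := hcompP x. Qed.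

Lemma hcompE x u : is_decomp x u -> hcomp x = u.
Proof. exact/decomp_uniq/hcompP. Qed.

Lemma hcompD a b i : hcomp (a + b) i = hcomp a i + hcomp b i.
Proof.
have [ga [N [a0 aE]]] := hcompP a; have [gb [M [b0 bE]]] := hcompP b.
rewrite (@hcompE _ (fun j => hcomp a j + hcomp b j)) //; split=> [j|].
  exact: grD.
exists (maxn N M); split=> [j jNM|]; first by rewrite a0 ?b0 ?addr0 //; lia.
rewrite big_split /= (sum_widen _ a0) ?(sum_widen _ b0) ?leq_maxl ?leq_maxr //.
by rewrite -aE -bE.
Qed.

Lemma hcomp_hom m a i : gr m a -> hcomp a i = if i == m then a else 0.
Proof.
move=> ga; rewrite (@hcompE _ (fun j => if j == m then a else 0)) //; split=> [j|].
  by case: eqP => [->|_] //; apply: gr_zero.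
exists m.+1; split=> [j mj|]; first by case: eqP => // jm; lia.
rewrite big_ord_recr /= eqxx big1 ?add0r // => j _.
by case: eqP (ltn_ord j) => // ->; rewrite ltnn.
Qed.

Lemma hcomp0 i : hcomp 0 i = 0.
Proof. by rewrite (hcomp_hom i (gr_zero 0)); case: ifP. Qed.

Lemma hcompN a i : hcomp (- a) i = - hcomp a i.
Proof. by apply/eqP; rewrite -addr_eq0 addrC -hcompD subrr hcomp0. Qed.

Lemma hcompB a b i : hcomp (a - b) i = hcomp a i - hcomp b i.
Proof. by rewrite hcompD hcompN. Qed.

Lemma hcomp_sum (T : Type) (r : seq T) (P : pred T) (F : T -> R) i :
  hcomp (\sum_(j <- r | P j) F j) i = \sum_(j <- r | P j) hcomp (F j) i.
Proof. by apply: (big_morph (hcomp^~ i)) => [a b|]; rewrite ?hcompD ?hcomp0. Qed.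

Lemma hcompM m z b i : gr m z ->
  hcomp (z * b) i = if (m <= i)%N then z * hcomp b (i - m) else 0.
Proof.
move=> gz; have [gb [N [b0 bE]]] := hcompP b.
rewrite (@hcompE _ (fun j => if (m <= j)%N then z * hcomp b (j - m) else 0)) //.
split=> [j|].
  case: ifP => [mj|_]; last exact: gr_zero.
  by rewrite -{1}(subnKC mj); apply: (grM grP).
exists (m + N)%N; split=> [j mNj|].
  by rewrite b0 ?mulr0 ?if_same //; lia.
rewrite big_split_ord /= big1 ?add0r => [|j _]; last by rewrite leqNgt ltn_ord.
rewrite [in LHS]bE mulr_sumr; apply: eq_bigr => j _.
by rewrite leq_addr addKn.
Qed.

Lemma hcomp_sumE x : exists N, x = \sum_(i < N) hcomp x i.
Proof. by have [_ [N [_ xE]]] := hcompP x; exists N. Qed.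

Definition homogeneous Q : Prop :=
  is_ideal Q /\ forall a, Q a -> forall i, Q (hcomp a i).

Lemma homogeneous0 : homogeneous [set 0].
Proof.
split; first split=> //.
- by move=> a b /= -> ->; rewrite addr0.
- by move=> a b /= ->; rewrite mulr0.
by move=> a /= -> i; rewrite hcomp0.
Qed.

Lemma homogeneous_gen S :
  (forall a, S a -> exists m, gr m a) -> homogeneous (ideal_gen S).
Proof.
move=> hS; have iS := ideal_gen_ideal S; split=> // a Sa i.
suff : forall j, ideal_gen S (hcomp a j) by apply.
move: a Sa; apply: ideal_gen_min.
  split=> [j|a b Ka Kb j|a b Kb j].
  - by rewrite hcomp0; apply: ideal0.
  - by rewrite hcompD; apply: (idealD iS (Ka j) (Kb j)).
  have [N ->] := hcomp_sumE a; rewrite mulr_suml hcomp_sum; apply: ideal_sum => // l _.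
  rewrite (hcompM _ _ (hcomp_gr a l)); case: ifP => _; last exact: ideal0.
  exact: (idealM _ iS (Kb _)).
move=> a Sa j; have [m ga] := hS _ Sa; rewrite (hcomp_hom _ ga).
by case: ifP => _; [apply: sub_ideal_gen | apply: ideal0].
Qed.

Lemma homogeneous_add_principal Q m z :
  gr m z -> homogeneous Q -> homogeneous (add_principal Q z).
Proof.
move=> gz [iQ hQ]; split; first exact: add_principal_ideal.
move=> a [b Qab] i; have := hQ _ Qab i; rewrite hcompB (hcompM _ _ gz).
case: ifP => _ Qi; first by exists (hcomp b (i - m)).
by exists 0; rewrite mulr0.
Qed.

Lemma gr_int0 (n : int) : gr_int gr n 0.
Proof. by case: n => // n; apply: gr_zero. Qed.

Lemma gr_intB (n : int) a b : gr_int gr n a -> gr_int gr n b -> gr_int gr n (a - b).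
Proof. by case: n => [n|n] /=; [apply: (grB grP) | move=> -> ->; rewrite subrr]. Qed.

Lemma gr_intN (n : int) a : gr_int gr n a -> gr_int gr n (- a).
Proof. by move=> ga; rewrite -sub0r; apply: gr_intB => //; apply: gr_int0. Qed.

Lemma gr_intD (n : int) a b : gr_int gr n a -> gr_int gr n b -> gr_int gr n (a + b).
Proof. by move=> ga gb; rewrite -(opprK b); apply: gr_intB => //; apply: gr_intN. Qed.

Lemma gr_int_sum (n : int) (T : Type) (r : seq T) (P : pred T) (F : T -> R) :
  (forall i, P i -> gr_int gr n (F i)) -> gr_int gr n (\sum_(i <- r | P i) F i).
Proof.
by move=> gF; apply: big_ind => //; [exact: gr_int0 | move=> a b; apply: gr_intD].
Qed.

Lemma gr_intM (m n : int) a b :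
  gr_int gr m a -> gr_int gr n b -> gr_int gr (m + n) (a * b).
Proof.
case: m => [m|m] /=; last by move=> ->; rewrite mul0r => _; apply: gr_int0.
case: n => [n|n]; last by move=> _ /= ->; rewrite mulr0; apply: gr_int0.
exact: (grM grP).
Qed.

Lemma gr_intX (m : int) z c : gr_int gr m z -> gr_int gr (c%:Z * m) (z ^+ c).
Proof.
move=> gz; elim: c => [|c IHc]; first by rewrite mul0r expr0; apply: (gr1 grP).
by rewrite exprS intS mulrDl mul1r; apply: gr_intM.
Qed.

(** The cofactor is a homogeneous component of an arbitrary one; integer degrees
    cover the case [m = 0], where it vanishes. *)
Lemma add_principal_int Q z (m : int) a : homogeneous Q -> gr 1 z ->
  gr_int gr m a -> add_principal Q z a ->
  exists2 b, gr_int gr (m - 1) b & Q (a - z * b).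
Proof.
move=> [iQ hQ] gz; case: m => [m|m] ga [b Qab]; last first.
  by exists 0; [apply: gr_int0 | rewrite (ga : a = 0) mulr0 subr0; apply: ideal0].
have := hQ _ Qab m; rewrite hcompB (hcomp_hom _ ga) eqxx (hcompM _ _ gz).
case: m {ga} => [|m] Qm.
  by exists 0; [apply: gr_int0 | rewrite mulr0].
exists (hcomp b (m.+1 - 1)) => //; rewrite -[_ - 1]/(_ + -1) intS addrC addKr subn1.
exact: hcomp_gr.
Qed.

End HomogeneousComponents.

(** * The Koszul complexes inside the Cech complex *)

Section Koszul.
Variables (R : comPzRingType) (r : nat) (y : 'I_r -> R).
Implicit Types (S T : {set 'I_r}) (u v w : {set 'I_r} -> R) (e c : nat).

Notation d e u := (cech_diff y e u).
Notation yS := (yprod y).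

Definition csgn T (t : 'I_r) : R := (-1) ^+ #|[set s in T | (s < t)%N]|.

Lemma csgn_sq T t : csgn T t * csgn T t = 1.
Proof. by rewrite -expr2 sqrr_sign. Qed.

Lemma csgnD1_lt T (a b : 'I_r) : (b < a)%N -> csgn (T :\ a) b = csgn T b.
Proof.
move=> ba; rewrite /csgn; congr ((-1) ^+ #|pred_of_set _|); apply/setP => s.
by rewrite !inE; case: (s =P a) => [->|//]; rewrite ltnNge (ltnW ba) /= andbF.
Qed.

Lemma csgnD1_gt T (a b : 'I_r) : a \in T -> (a < b)%N ->
  csgn (T :\ a) b = - csgn T b.
Proof.
move=> aT ab; rewrite /csgn [in RHS](cardsD1 a) inE aT ab /= exprS mulN1r opprK.
congr ((-1) ^+ #|pred_of_set _|); apply/setP => s.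
by rewrite !inE andbA.
Qed.

(** Removing [a] changes the rank of [b] in [T] exactly when [a < b]. This sign rule
    is behind both the equation [d d = 0] and the Koszul homotopy. *)
Lemma csgn_swap T (a b : 'I_r) : a \in T -> b \in T -> a != b ->
  csgn T a * csgn (T :\ a) b = - (csgn T b * csgn (T :\ b) a).
Proof.
move=> aT bT; rewrite neq_ltn => /orP[ab|ba].
  by rewrite (csgnD1_gt aT ab) (csgnD1_lt _ ab) mulrN mulrC.
by rewrite (csgnD1_lt _ ba) (csgnD1_gt bT ba) mulrN opprK mulrC.
Qed.

Lemma cech_diffE e u T :
  d e u T = \sum_(t in T) csgn T t * (y t ^+ e * u (T :\ t)).
Proof. by []. Qed.

Lemma cech_diffD e u v T : d e (fun S => u S + v S) T = d e u T + d e v T.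
Proof. by rewrite !cech_diffE -big_split; apply: eq_bigr => t _; rewrite !mulrDr. Qed.

Lemma cech_diffZ e a u T : d e (fun S => a * u S) T = a * d e u T.
Proof.
by rewrite !cech_diffE mulr_sumr; apply: eq_bigr => t _; ring.
Qed.

Lemma cech_diffB e u v T : d e (fun S => u S - v S) T = d e u T - d e v T.
Proof.
rewrite (_ : d e u T - _ = d e u T + (-1) * d e v T); last by rewrite mulN1r.
rewrite -cech_diffZ -cech_diffD; congr cech_diff; apply/funext => S.
by rewrite mulN1r.
Qed.

Lemma cech_diff_sum e (J : Type) (s : seq J) (u : J -> {set 'I_r} -> R) T :
  d e (fun S => \sum_(j <- s) u j S) T = \sum_(j <- s) d e (u j) T.
Proof.
elim: s => [|j s IHs].
  rewrite big_nil cech_diffE big1 // => t _; by rewrite big_nil !mulr0.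
rewrite big_cons -IHs -cech_diffD; congr cech_diff; apply/funext => S.
by rewrite big_cons.
Qed.

Lemma cech_diff_ideal (Q : set R) e u p T : is_ideal Q -> #|T| = p.+1 ->
  (forall S, #|S| = p -> Q (u S)) -> Q (d e u T).
Proof.
move=> iQ cT Qu; rewrite cech_diffE; apply: ideal_sum => // t tT.
do 2!apply: idealM => //; apply: Qu; move: cT; rewrite (cardsD1 t) tT add1n.
by case.
Qed.

(** Passing from denominators [y_S ^ e] to denominators [y_S ^ (e + c)]. *)
Definition raise c u : {set 'I_r} -> R := fun S => yS S ^+ c * u S.

Lemma yprodD1 T t : t \in T -> yS T = y t * yS (T :\ t).
Proof. by move=> tT; rewrite /yprod (big_setD1 t). Qed.

Lemma cech_diff_raise e c u T : d (e + c) (raise c u) T = yS T ^+ c * d e u T.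
Proof.
rewrite !cech_diffE mulr_sumr; apply: eq_bigr => t tT.
rewrite /raise (yprodD1 tT) exprMn exprD; ring.
Qed.

(** Each unordered pair of removed vertices contributes twice, with opposite signs;
    splitting along [a < b] keeps the argument valid in characteristic 2. *)
Lemma cech_diff_diff e u T : d e (d e u) T = 0.
Proof.
pose f a b := csgn T a * csgn (T :\ a) b *
  (y a ^+ e * (y b ^+ e * u (T :\ a :\ b))).
have fN a b : a \in T -> b \in T -> a != b -> f a b = - f b a.
  move=> aT bT ab; rewrite /f (csgn_swap aT bT ab) mulNr; congr (- (_ * _)).
  by rewrite mulrCA finset.setDDl finset.setUC -finset.setDDl.
have -> : d e (d e u) T = \sum_(a in T) \sum_(b in T | a != b) f a b.
  rewrite cech_diffE; apply: eq_bigr => a aT; rewrite cech_diffE !mulr_sumr.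
  apply: eq_big => [b|b _]; first by rewrite !inE eq_sym andbC.
  by rewrite /f; ring.
have -> : \sum_(a in T) \sum_(b in T | a != b) f a b =
  \sum_(a in T) \sum_(b in T | (a < b)%N) f a b +
  \sum_(a in T) \sum_(b in T | (b < a)%N) f a b.
  rewrite -big_split; apply: eq_bigr => a aT /=.
  rewrite (bigID (fun b : 'I_r => (a < b)%N)) /=; congr (_ + _); apply: eq_bigl => b;
    case: (b \in T) => //=; rewrite -(inj_eq val_inj) /=; lia.
rewrite [X in X + _](exchange_big_dep (fun b => b \in T)) /=; last by move=> ? ? _ /andP[].
rewrite -big_split big1 // => b bT /=; apply/eqP; rewrite addr_eq0; apply/eqP.
rewrite -sumrN; apply: eq_big => [a|a /and3P[aT _ ab]]; first by rewrite bT.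
by apply: fN => //; rewrite neq_ltn ab.
Qed.

(** Contraction with the basis vector [j]; by the next lemma it is a null-homotopy of
    multiplication by [y_j ^ e] on the complex with denominators [y_S ^ e]. *)
Definition koszul_homotopy j u : {set 'I_r} -> R :=
  fun S => if j \in S then 0 else csgn (j |: S) j * u (j |: S).

Lemma koszul_homotopyP e j u T :
  y j ^+ e * u T =
  d e (koszul_homotopy j u) T + koszul_homotopy j (d e u) T.
Proof.
rewrite {2}/koszul_homotopy; case: ifP => jT.
  rewrite addr0 cech_diffE (bigD1 j) //= big1 ?addr0 => [|t /andP[tT tj]].
    rewrite /koszul_homotopy finset.setD11 finset.setD1K //.
    by rewrite -[LHS]mul1r -(csgn_sq T j); ring.
  by rewrite /koszul_homotopy !inE eq_sym tj jT !mulr0.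
set X := j |: T; have jX : j \in X by rewrite !inE eqxx.
have XT : X :\ j = T by rewrite finset.setU1K // jT.
rewrite [d e u X]cech_diffE (bigD1 j) //= XT mulrDr mulrA csgn_sq mul1r addrCA.
rewrite -[LHS]addr0; congr (_ + _).
rewrite cech_diffE mulr_sumr.
have bigE : forall t, (t \in X) && (t != j) = (t \in T).
  by move=> t; rewrite -XT !inE andbC.
rewrite (eq_bigl _ _ bigE) -big_split big1 //= => t tT.
have tj : t != j by apply: contraFneq jT => <-.
have XtE : j |: T :\ t = X :\ t.
  by apply/setP=> s; rewrite !inE; case: (s =P j) => // ->; rewrite eq_sym tj.
rewrite /koszul_homotopy !inE eq_sym tj jT /= XtE.
have tX : t \in X by rewrite !inE tT orbT.
have := csgn_swap jX tX; rewrite eq_sym tj XT => /(_ isT) swp.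
rewrite [csgn X j * (_ * _)]mulrA.
have -> : csgn X j * csgn X t = - (csgn T t * csgn (X :\ t) j).
  have H2 := csgn_sq X t; have H3 := csgn_sq T t.
  rewrite -[LHS]mulr1 -H3 mulrACA [csgn X j * csgn T t]swp.
  by rewrite mulNr mulrACA H2 mul1r [_ * csgn T t]mulrC.
ring.
Qed.

End Koszul.

(** * Cech cohomology of quotients by homogeneous ideals *)

Section Acyclicity.
Variables (R : comPzRingType) (gr : nat -> set R) (r : nat) (y : 'I_r -> R).
Hypothesis grP : grading gr.
Hypothesis gy : forall j, gr 1%N (y j).
Implicit Types (S T : {set 'I_r}) (u v w : {set 'I_r} -> R) (e c p q : nat).
Implicit Types (Q : set R) (z : R) (n : int).

Notation d e u := (cech_diff y e u).
Notation yS := (yprod y).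
Notation hom := (gr_int gr).

Lemma hom_eq (m m' : int) a : m = m' -> hom m a -> hom m' a.
Proof. by move->. Qed.

Lemma gr_yprod S : gr #|S| (yS S).
Proof.
rewrite -sum1_card; apply: (big_ind2 (fun a m => gr m a)) => //.
  exact: gr1.
by move=> a m b m'; apply: grM.
Qed.

Lemma hom_yprodX S c : hom (c * #|S|)%N%:Z (yS S ^+ c).
Proof. by rewrite PoszM; apply: gr_intX => //; apply: gr_yprod. Qed.

Lemma cech_cochain_raise p n e c u :
  cech_cochain gr p n e u -> cech_cochain gr p n (e + c) (raise y c u).
Proof.
move=> hu S cS; have := gr_intM grP (hom_yprodX S c) (hu S cS).
by apply: hom_eq; rewrite cS; lia.
Qed.

Lemma cech_cochain_diff p n e v :
  (forall q, q.+1 = p -> cech_cochain gr q n e v) ->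
  cech_cochain gr p n e (d e v).
Proof.
move=> hv T cT; rewrite cech_diffE; apply: (gr_int_sum grP) => t tT.
have cTt : #|T :\ t|.+1 = p by rewrite -cT [in RHS](cardsD1 t) tT.
have gt : hom e%:Z (y t ^+ e).
  by have := gr_intX grP e (gy t : hom 1 (y t)); rewrite mulr1.
have gs : hom 0 (csgn R T t) by have := gr_intX grP #|[set s in T | (s < t)%N]|
  (gr_intN grP (gr1 grP : hom 0 1)); rewrite mulr0.
have := gr_intM grP gs (gr_intM grP gt (hv _ cTt _ (erefl _))).
by apply: hom_eq; rewrite -cTt; lia.
Qed.

(** The Cech complex of [R / Q] is the direct limit over [e] of the Koszul
    complexes of the [y_j ^ e].  Cocycles and coboundaries are therefore taken
    in these complexes, with exact congruences modulo [Q] and, for the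
    coboundaries, a larger exponent. *)
Definition koszul_cocycle Q p n e u : Prop :=
  cech_cochain gr p n e u /\ forall T, #|T| = p.+1 -> Q (d e u T).

Definition koszul_coboundary Q p n e u : Prop :=
  exists f v, (forall q, q.+1 = p -> cech_cochain gr q n (e + f) v) /\
    forall T, #|T| = p -> Q (yS T ^+ f * u T - d (e + f) v T).

Definition cech_acyclic Q p n : Prop :=
  forall e u, koszul_cocycle Q p n e u -> koszul_coboundary Q p n e u.

(** The torsion exponents allowed in an equality of fractions differ from one
    [T] to another, but there are finitely many [T], so that all of them can be
    absorbed in the common denominator. *)
Lemma cech_nonzeroE p n : cech_nonzero gr y p n <-> ~ cech_acyclic [set 0] p n.
Proof.
split=> [[e [u [[hu zu] nBu]] acy]|].
  apply: nBu.
  have [c zc] : exists c, forall T, #|T| = p.+1 -> yS T ^+ c * d e u T = 0.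
    apply: uniform_bound => [T c c' cc' H /H|T].
      by rewrite -(subnK cc') exprD -mulrA => ->; rewrite mulr0.
    case: (#|T| =P p.+1) => [/zu[c]|nT]; last by exists 0%N => /nT.
    by rewrite mulr0 subr0 mul1r => H; exists c.
  have [|f [v [hv bv]]] := acy (e + c)%N (raise y c u).
    split=> [|T cT]; first exact: cech_cochain_raise.
    by rewrite cech_diff_raise; apply: zc.
  exists (e + c + f)%N, v; split=> // T cT; exists 0%N; rewrite expr0 mul1r.
  have /subr0_eq <- := bv T cT; rewrite /raise !exprD; ring.
move=> /existsNP[e] /existsNP[u] /not_implyP[[hu zu] nBu].
exists e, u; split.
  split=> // T cT; exists 0%N; rewrite mulr0 subr0 zu //; ring.
move=> [f [v [hv bv]]]; apply: nBu.
have [c zc] : exists c, forall T, #|T| = p ->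
    yS T ^+ c * (yS T ^+ f * u T - yS T ^+ e * d f v T) = 0.
  apply: uniform_bound => [T c c' cc' H /H|T].
    by rewrite -(subnK cc') exprD -mulrA => ->; rewrite mulr0.
  by case: (#|T| =P p) => [/bv[c Hc]|nT]; [exists c | exists 0%N => /nT].
exists (f + c)%N, (raise y (e + c) v); rewrite addnCA; split=> [q qp|T cT].
  by apply: cech_cochain_raise; apply: hv.
rewrite cech_diff_raise /= -(zc T cT) !exprD; ring.
Qed.

Definition filter_regular Q z (t : nat) : Prop :=
  forall m, (t < m)%N -> forall a, gr m a -> Q (z * a) -> Q a.

(** A filter-regular element is a nonzerodivisor on the localizations at
    [y_T], because multiplying by [y_T] raises the degree when [T] is not empty. *)
Lemma filter_regular_loc Q z t c T p (m : int) a : is_ideal Q ->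
  filter_regular Q z t -> (t < c)%N -> #|T| = p.+1 ->
  hom m a -> Q (z * a) -> Q (yS T ^+ c * a).
Proof.
move=> iQ regz tc cT; case: m => [m|m] ga Qza; last first.
  by rewrite (ga : a = 0) mulr0; apply: ideal0.
apply: (regz (c * #|T| + m)%N); last by rewrite mulrCA; apply: idealM.
  by rewrite cT; nia.
exact: (gr_intM grP (hom_yprodX T c) ga).
Qed.

Hypothesis genY : forall z, gr 1%N z -> ideal_gen (range y) z.

(** A large power of a linear combination of the [y_j] lies in the ideal of the
    [y_j ^ e]; taking components makes the coefficients homogeneous. *)
Lemma pow_linear_form z e : gr 1%N z -> exists N (g : 'I_r -> R),
  (forall j, hom (N%:Z - e%:Z) (g j)) /\ z ^+ N = \sum_j y j ^+ e * g j.
Proof.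
move=> gz; have [b zE] := ideal_gen_rangeP (genY gz).
pose K : set R := [set a | exists g : 'I_r -> R, a = \sum_j y j ^+ e * g j].
have iK : is_ideal K.
  split=> [|a a' [g ->] [g' ->]|c a [g ->]].
  - by exists (fun=> 0); rewrite big1 // => j _; rewrite mulr0.
  - by exists (fun j => g j + g' j); rewrite -big_split; apply: eq_bigr => j _; rewrite mulrDr.
  by exists (fun j => c * g j); rewrite mulr_sumr; apply: eq_bigr => j _; rewrite mulrCA.
have [N [g zN]] : exists N, K (z ^+ N).
  rewrite zE; apply: pow_mem_ideal_sum => // j; exists e; rewrite exprMn.
  apply: idealM => //; exists (fun i => (i == j)%:R); rewrite (bigD1 j) //= eqxx mulr1.
  by rewrite big1 ?addr0 // => i /negPf ->; rewrite mulr0.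
have gX (j : nat) (w : R) : gr 1%N w -> gr j (w ^+ j).
  by move=> gw; have := gr_intX grP j (gw : hom 1 w); rewrite mulr1.
exists N, (fun j => if (e <= N)%N then hcomp grP (g j) (N - e) else 0); split=> [j|].
  case: ifP => [eN|_]; last exact: gr_int0.
  by rewrite subzn //; apply: hcomp_gr.
have := congr1 (fun a => hcomp grP a N) zN.
rewrite (hcomp_hom grP _ (gX N z gz)) eqxx => ->; rewrite hcomp_sum.
apply: eq_bigr => j _; rewrite (hcompM grP _ _ (gX e _ (gy j))).
by case: ifP => // _; rewrite mulr0.
Qed.

(** Local cohomology is killed by powers of [R_+], by the Koszul homotopies. *)
Lemma pow_coboundary Q z p n e u : is_ideal Q -> gr 1%N z ->
  koszul_cocycle Q p n e u ->
  exists N : nat, koszul_coboundary Q p (n + N%:Z) e (fun S => z ^+ N * u S).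
Proof.
move=> iQ gz [hu zu]; have [N [g [hg zN]]] := pow_linear_form e gz.
exists N, 0%N, (fun S => \sum_j g j * koszul_homotopy j u S).
rewrite addn0; split=> [q qp S cS|T cT].
  apply: (gr_int_sum grP) => j _.
  rewrite /koszul_homotopy; case: ifPn => jS; first by rewrite mulr0; apply: gr_int0.
  have gs : hom 0 (csgn R (j |: S) j).
    by have := gr_intX grP #|[set s in j |: S | (s < j)%N]|
      (gr_intN grP (gr1 grP : hom 0 1)); rewrite mulr0.
  have cjS : #|j |: S| = p by rewrite cardsU1 jS cS add1n.
  have := gr_intM grP (hg j) (gr_intM grP gs (hu _ cjS)).
  by apply: hom_eq; rewrite -qp; lia.
rewrite expr0 mul1r cech_diff_sum zN mulr_suml -sumrB; apply: ideal_sum => // j _.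
rewrite cech_diffZ mulrAC mulrC -mulrBr (koszul_homotopyP y e j u T) addrC addKr.
apply: idealM => //; rewrite /koszul_homotopy; case: ifPn => jT; first exact: ideal0.
by apply: idealM => //; apply: zu; rewrite cardsU1 jT cT.
Qed.

End Acyclicity.

Section AcyclicSteps.
Variables (R : comPzRingType) (gr : nat -> set R) (r : nat) (y : 'I_r -> R).
Hypothesis grP : grading gr.
Hypothesis gy : forall j, gr 1%N (y j).
Hypothesis genY : forall z, gr 1%N z -> ideal_gen (range y) z.
Implicit Types (S T : {set 'I_r}) (u v w : {set 'I_r} -> R) (e c p q : nat).
Implicit Types (Q : set R) (z : R) (n : int).

Notation d e u := (cech_diff y e u).
Notation yS := (yprod y).
Notation hom := (gr_int gr).
Notation koszul_cocycle := (koszul_cocycle gr y).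
Notation koszul_coboundary := (koszul_coboundary gr y).
Notation cech_acyclic := (cech_acyclic gr y).

(** Turns congruences modulo [Q + zR] between cochains into congruences modulo [Q]
    that involve one more homogeneous cochain. *)
Lemma cochain_cofactor Q z p n e u : homogeneous grP Q -> gr 1%N z ->
  cech_cochain gr p n e u -> (forall S, #|S| = p -> add_principal Q z (u S)) ->
  exists v, cech_cochain gr p (n - 1) e v /\
    forall S, #|S| = p -> Q (u S - z * v S).
Proof.
move=> hQ gz hu Qu.
have /choice[v Hv] S : exists b, #|S| = p ->
    hom (n - 1 + (e * p)%N%:Z) b /\ Q (u S - z * b).
  case: (#|S| =P p) => [cS|nS]; last by exists 0 => /nS.
  have [b hb Qb] := add_principal_int hQ gz (hu S cS) (Qu S cS).
  by exists b => _; split=> //; apply: hom_eq hb; lia.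
by exists v; split=> S /Hv[].
Qed.

(** The exact cohomology sequence of multiplication by [z] on [R / Q]: as
    [H^(p-1)] of [R / (Q + zR)] vanishes in degree [n + 1], multiplication by [z] is
    injective from degree [n] to degree [n + 1] of [H^p] of [R / Q]. For [p = 0] the
    filter-regularity of [z] says the same. *)
Lemma coboundary_div Q z (t : nat) p n e u : homogeneous grP Q -> gr 1%N z ->
  filter_regular gr Q z t ->
  (forall p n, t%:Z < n + p%:Z -> cech_acyclic (add_principal Q z) p n) ->
  t%:Z < n + p%:Z -> koszul_cocycle Q p n e u ->
  koszul_coboundary Q p (n + 1) e (fun S => z * u S) ->
  koszul_coboundary Q p n e u.
Proof.
move=> hQ gz regz acy tnp [hu zu] [f [v [hv bv]]]; have iQ := hQ.1.
case: p => [|q] in tnp hu zu hv bv *.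
  exists 0%N, (fun=> 0); split=> // T cT; have T0 := cards0_eq cT.
  have := bv T cT; rewrite T0 !cech_diffE !big_set0 !subr0.
  rewrite /yprod big_set0 !expr1n !mul1r => Qzu.
  have := hu _ (cards0 _); case: n tnp {hu zu hv} => [m|m] tm; last by lia.
  rewrite muln0 /= addn0 => gu; by apply: (regz m _ _ gu Qzu); lia.
(* [z u = d v]; modulo [Q + z] the cochain [v] is a cocycle, so
   [v = d w + z v'] and [z (u - d v') = 0]. *)
set E := (e + f)%N in hv bv.
have {}hv := hv q (erefl _).
have tnq : t%:Z < n + 1 + q%:Z by lia.
have [|g [w [hw bw]]] := acy q (n + 1) tnq E v.
  split=> // T cT; exists (yS T ^+ f * u T).
  by rewrite -opprB mulrCA; apply: idealN => //; apply: bv.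
have [v' [hv' Qv']] : exists v', cech_cochain gr q n (E + g) v' /\
    forall S, #|S| = q -> Q (yS S ^+ g * v S - d (E + g) w S - z * v' S).
  have [|v' [hv' Qv']] := cochain_cofactor (n := n + 1) (e := (E + g)%N) hQ gz _ bw.
    move=> S cS; apply: gr_intB => //.
      exact: (cech_cochain_raise grP gy g hv cS).
    exact: (cech_cochain_diff grP gy hw cS).
  by exists v'; split=> // S cS; apply: hom_eq (hv' S cS); lia.
pose a T := yS T ^+ (g + f) * u T - d (E + g) v' T.
have Qza T : #|T| = q.+1 -> Q (z * a T).
  move=> cT; have := cech_diff_ideal y (E + g) iQ cT Qv'.
  rewrite !cech_diffB cech_diffZ cech_diff_diff subr0 -/(raise y g v) cech_diff_raise.
  have Q1 := idealM (yS T ^+ g) iQ (bv T cT).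
  move=> Q2; have := idealD iQ Q1 Q2; congr (Q _).
  by rewrite /a exprD; ring.
have ha T : #|T| = q.+1 -> hom (n + ((E + g) * q.+1)%N%:Z) (a T).
  move=> cT; apply: (gr_intB grP); last first.
    by apply: (cech_cochain_diff grP gy) => // q' [->].
  by have := cech_cochain_raise grP gy (g + f)%N hu cT; apply: hom_eq; rewrite /E; lia.
exists (f + g + t.+1)%N, (raise y t.+1 v').
rewrite !addnA -/E; split=> [q' [->]|T cT].
  exact: (cech_cochain_raise grP gy _ hv').
have := filter_regular_loc grP gy iQ regz (ltnSn t) cT (ha T cT) (Qza T cT).
by congr (Q _); rewrite cech_diff_raise /a !exprD; ring.
Qed.

(** Multiplication by [z] is injective on the classes in question by
    [coboundary_div], and nilpotent on each of them by [pow_coboundary]. *)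
Lemma cech_acyclic_down Q z (t : nat) : homogeneous grP Q -> gr 1%N z ->
  filter_regular gr Q z t ->
  (forall p n, t%:Z < n + p%:Z -> cech_acyclic (add_principal Q z) p n) ->
  forall p n, t%:Z < n + p%:Z -> cech_acyclic Q p n.
Proof.
move=> hQ gz regz acy p n tnp e u cu; have [N] := pow_coboundary grP gy genY hQ.1 gz cu.
elim: N => [|N IHN].
  rewrite addr0; congr (koszul_coboundary _ _ _ _ _); apply/funext => S.
  by rewrite mul1r.
move=> bu; apply: IHN; apply: (coboundary_div (t := t) hQ gz) => //.
- lia.
- have [hu zu] := cu; split=> [S cS|T cT].
    have := gr_intM grP (gr_intX grP N (gz : hom 1 z)) (hu S cS).
    by apply: hom_eq; lia.
  by rewrite cech_diffZ; apply: idealM; [exact: hQ.1 | apply: zu].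
move: bu; rewrite -addrA -PoszD addn1; congr (koszul_coboundary _ _ _ _ _).
by apply/funext => S; rewrite exprS mulrA.
Qed.

(** [H^0] consists of the elements killed by powers of all [y_j]. *)
Lemma torsion_acyclic Q (m c : nat) a : is_ideal Q -> cech_acyclic Q 0 m%:Z ->
  gr m a -> (forall j, Q (y j ^+ c * a)) -> Q a.
Proof.
move=> iQ acy ga Qya; have [|f [v [_ bv]]] := acy c (fun=> a).
  split=> [S _|T cT]; first by rewrite muln0 addr0.
  have /eqP/cards1P[j ->] := cT.
  by rewrite cech_diffE big_set1; apply: idealM.
have := bv finset.set0 (cards0 _).
by rewrite cech_diffE big_set0 subr0 /yprod big_set0 expr1n mul1r.
Qed.

(** The same exact sequence read in the other direction: the annihilator of [z] in
    [R / Q] is torsion, hence contained in [H^0], and [H^p] of [R / (Q + zR)] in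
    degree [n] lies between [H^p] in degree [n] and [H^(p+1)] in degree [n - 1]
    of [R / Q]. *)
Lemma cech_acyclic_up Q z (t0 : nat) (t : int) : homogeneous grP Q -> gr 1%N z ->
  filter_regular gr Q z t0 ->
  (forall p n, t <= n + p%:Z -> cech_acyclic Q p n) ->
  (forall m : nat, t <= m%:Z -> forall a, gr m a -> Q (z * a) -> Q a) /\
  (forall p n, t <= n + p%:Z -> cech_acyclic (add_principal Q z) p n).
Proof.
move=> hQ gz regz acy; have iQ := hQ.1; split=> [m tm a ga Qza|p n tnp e u [hu zu]].
  apply: (torsion_acyclic (c := t0.+1) iQ (acy 0%N m%:Z _) ga) => //.
    by rewrite addr0.
  move=> j; have := filter_regular_loc grP gy iQ regz (ltnSn _) (cards1 j) (ga : hom m a) Qza.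
  by rewrite /yprod big_set1.
(* [d u = z w] with [d w = 0] away from torsion, so [w = d w'] and
   [u - z w'] is a cocycle modulo [Q]. *)
have hdu : cech_cochain gr p.+1 n e (d e u).
  by apply: (cech_cochain_diff grP gy) => q [->].
have [w [hw Qw]] := cochain_cofactor hQ gz hdu zu.
pose c := t0.+1.
have zw (X : {set 'I_r}) : #|X| = p.+2 -> Q (yS X ^+ c * d e w X).
  move=> cX; have := cech_diff_ideal y e iQ cX Qw.
  rewrite cech_diffB cech_diff_diff cech_diffZ sub0r => /(idealN iQ).
  rewrite opprK; apply: (filter_regular_loc grP gy iQ regz (ltnSn _) cX).
  by apply: (cech_cochain_diff grP gy _ cX) => q [->]; exact: hw.
have tnp1 : t <= n - 1 + p.+1%:Z by lia.
have [|f [w' [hw' bw']]] := acy p.+1 (n - 1) tnp1 (e + c)%N (raise y c w).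
  split; first exact: (cech_cochain_raise grP gy _ hw).
  by move=> X cX; rewrite cech_diff_raise; apply: zw.
have {}hw' := hw' p (erefl _).
pose u2 S := yS S ^+ (c + f) * u S - z * w' S.
have [|g [v [hv bv]]] := acy p n tnp (e + c + f)%N u2.
  split=> [S cS|T cT].
    apply: (gr_intB grP).
      have := cech_cochain_raise grP gy (c + f)%N hu cS.
      by apply: hom_eq; lia.
    by have := gr_intM grP (gz : hom 1 z) (hw' S cS); apply: hom_eq; lia.
  rewrite cech_diffB cech_diffZ -/(raise y (c + f) u) -addnA cech_diff_raise.
  have Q1 := idealM (yS T ^+ (c + f)) iQ (Qw T cT).
  have Q2 := idealM z iQ (bw' T cT).
  have := idealD iQ Q1 Q2; congr (Q _).
  by rewrite /raise addnA !exprD; ring.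
exists (c + f + g)%N, v; rewrite !addnA; split=> // T cT.
exists (yS T ^+ g * w' T).
have := bv T cT; congr (Q _); rewrite /u2 !exprD; ring.
Qed.

(** Multiplying by [y_T] moves every component into the degrees where [R / Q] is zero. *)
Lemma cech_acyclic_bounded Q (t : nat) : is_ideal Q ->
  (forall m, (t < m)%N -> gr m `<=` Q) ->
  forall p n, t%:Z < n + p%:Z -> cech_acyclic Q p n.
Proof.
move=> iQ Qgr p n tnp e u [hu zu]; exists t.+1, (fun=> 0); split=> [q _ S _|T cT].
  exact: gr_int0.
rewrite cech_diffE big1 ?subr0 => [|j _]; last by rewrite !mulr0.
have gT := gr_intM grP (hom_yprodX grP gy T t.+1) (hu T cT).
case: p => [|p] in tnp hu zu cT gT *.
  move: gT; rewrite cT !muln0 addr0 add0r; case: n tnp {hu} => [m|m] tm; last by lia.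
  by apply: Qgr; lia.
have := hu T cT; case En : (n + _) => [m|m] gu; last first.
  by rewrite (gu : u T = 0) mulr0; apply: ideal0.
by move: gT; rewrite En cT; apply: Qgr; nia.
Qed.

End AcyclicSteps.

(** * Regularity from a filter-regular sequence *)

Section FilterRegularSequences.
Variables (R : comPzRingType) (gr : nat -> set R).
Variables (z : nat -> R) (good : nat -> bool).

(** Adding the forms one at a time lets an induction on [i] pass from [R / Q] to
    [R / (Q + zR)]. Terms that are not [good] are skipped: in the fiber ring they
    stand for elements whose degree is too large. *)
Fixpoint partial_ideal i : set R :=
  if i is j.+1 then
    if good j then add_principal (partial_ideal j) (z j) else partial_ideal j
  else [set 0].

Definition regular_from (s t : nat) : Prop :=
  (forall m, (t <= m)%N -> gr m `<=` partial_ideal s) /\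
  forall i, (i < s)%N -> good i -> forall m, (t <= m)%N ->
    forall a, gr m a -> partial_ideal i (z i * a) -> partial_ideal i a.

Hypothesis grP : grading gr.
Hypothesis gz : forall i, good i -> gr 1%N (z i).

Lemma partial_ideal_homogeneous i : homogeneous grP (partial_ideal i).
Proof.
elim: i => [|i IHi] /=; first exact: homogeneous0.
by case: ifP => // gi; apply: homogeneous_add_principal IHi; apply: gz.
Qed.

Section WithGenerators.
Variables (r : nat) (y : 'I_r -> R).
Hypothesis gy : forall j, gr 1%N (y j).
Hypothesis genY : ideal_gen (range y) = irrelevant_ideal gr.

Let genY1 a : gr 1%N a -> ideal_gen (range y) a.
Proof. by move=> ga; rewrite genY; apply: sub_ideal_gen; exists 1%N. Qed.

(** Descending induction on the number of forms divided out, starting from a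
    quotient that vanishes in degrees greater than [t]. *)
Lemma acyclic_of_regular s t : regular_from s t.+1 ->
  forall p n, t%:Z < n + p%:Z -> cech_acyclic gr y [set 0] p n.
Proof.
move=> [Qs Qreg].
suff H k : (k <= s)%N -> forall p n, t%:Z < n + p%:Z ->
    cech_acyclic gr y (partial_ideal (s - k)) p n.
  by have := H s (leqnn s); rewrite subnn.
elim: k => [|k IHk] ks.
  by rewrite subn0; apply: cech_acyclic_bounded => //; have [] := partial_ideal_homogeneous s.
have {}IHk := IHk (ltnW ks); set i := (s - k.+1)%N.
have iE : (s - k)%N = i.+1 by rewrite /i; lia.
have is_ : (i < s)%N by rewrite /i; lia.
move: IHk; rewrite iE /=; case: ifP => // gi IHk.
apply: (cech_acyclic_down gy genY1 (partial_ideal_homogeneous i) (gz gi)) => //.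
by move=> m tm a; apply: Qreg.
Qed.

(** Ascending induction: vanishing passes to the successive quotients, and in
    degree zero cohomology it is the required regularity. *)
Lemma regular_of_acyclic s t0 (t : nat) : regular_from s t0.+1 ->
  (forall p n, t%:Z <= n + p%:Z -> cech_acyclic gr y [set 0] p n) ->
  regular_from s t.
Proof.
move=> [Qs Qreg] acy0.
have reg i : (i < s)%N -> good i -> filter_regular gr (partial_ideal i) (z i) t0.
  by move=> si gi m tm a; apply: Qreg.
have acy i : (i <= s)%N -> forall p n, t%:Z <= n + p%:Z ->
    cech_acyclic gr y (partial_ideal i) p n.
  elim: i => [|i IHi] // si; have {}IHi := IHi (ltnW si).
  rewrite /=; case: ifP => // gi.
  exact: (cech_acyclic_up gy (partial_ideal_homogeneous i) (gz gi) (reg i si gi) IHi).2.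
split=> [m tm a ga|i si gi m tm a].
  have iQ := (partial_ideal_homogeneous s).1.
  have tm0 : t%:Z <= m%:Z + 0%:Z by rewrite addr0.
  apply: (torsion_acyclic (c := t0.+1) iQ (acy s (leqnn s) 0%N m%:Z tm0) ga) => j.
  have gyj := gr_intX grP t0.+1 (gy j : gr_int gr 1 (y j)); rewrite mulr1 in gyj.
  by apply: (Qs (t0.+1 + m)%N); [lia | apply: (grM grP)].
exact: ((cech_acyclic_up gy (partial_ideal_homogeneous i) (gz gi) (reg i si gi) (acy i (ltnW si))).1 m tm a).
Qed.

End WithGenerators.

(** By [acyclic_of_regular], [t] bounds all [n + p] with [H^p] nonzero in degree [n].
    If no such pair reached [t], then [regular_of_acyclic] would give the conditions
    from degree [t] on, against the minimality of [t] when [t > 0], and against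
    [1] lying outside [partial_ideal s] when [t = 0]. *)
Lemma reg_filter_regular (s t : nat) :
  (exists r (y : 'I_r -> R), (forall j, gr 1%N (y j)) /\
     ideal_gen (range y) = irrelevant_ideal gr) ->
  ~ partial_ideal s 1 ->
  is_least (fun t => regular_from s t.+1) t -> is_reg gr t%:Z.
Proof.
move=> [r [y [gy genY]]] Qs1 [regt tmin].
have bound p n : loc_coh_nonzero gr p n -> n + p%:Z <= t%:Z.
  move=> [r' [y' [gy' genY' /(cech_nonzeroE grP gy') nz]]].
  rewrite leNgt; apply/negP => tnp; apply: nz.
  exact: (acyclic_of_regular gy' genY' regt).
have a_inv p : exists a, is_a_invariant gr p a.
  have [[n nzn]|nz] := pselect (loc_coh_nonzero gr p !=set0).
    have [|m mmax] := @int_set_max (loc_coh_nonzero gr p) (t%:Z - p%:Z) (ex_intro _ n nzn).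
      by move=> n' /bound; lia.
    by exists (Some m).
  by exists None; apply/eqP; apply: contra_notT nz => /set0P.
split=> //; split; last first.
  by move=> m [p [a [[nza _] ->]]]; apply: bound.
suff [p [n [nz tE]]] : exists p n, loc_coh_nonzero gr p n /\ n + p%:Z = t%:Z.
  exists p, n; split=> //; split=> // n' /bound; lia.
apply: contrapT => none.
have acy p n : t%:Z <= n + p%:Z -> cech_acyclic gr y [set 0] p n.
  rewrite le_eqVlt => /orP[/eqP tE|]; last exact: (acyclic_of_regular gy genY regt).
  apply: contrapT => nacy; apply: none; exists p, n; split=> //.
  by exists r, y; split=> //; apply/(cech_nonzeroE grP gy).
have := regular_of_acyclic gy regt acy.
case: t {regt bound a_inv none acy} tmin => [|t] tmin [Qt regt].
  by apply: Qs1; apply: (Qt 0%N) => //; apply: gr1.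
by have := tmin t (conj Qt regt); rewrite ltnn.
Qed.

End FilterRegularSequences.

(** * Noetherian subrings *)

(** If no finite part of [K] spans it, then elements of least measure outside the span
    of the previous ones can be chosen forever. *)
Lemma greedy_sequence (T : eqType) (K : set T) (sp : seq T -> set T)
    (mu : T -> nat) :
  (forall s, (forall a, a \in s -> K a) -> exists g, K g /\ ~ sp s g) ->
  exists f : nat -> T, forall n, [/\ K (f n), ~ sp (mkseq f n) (f n) &
    forall g, K g -> ~ sp (mkseq f n) g -> (mu (f n) <= mu g)%N].
Proof.
move=> Ksp; have [g0 _] := Ksp [::] (fun a => ltac:(by [])).
have /choice[next nextP] (s : seq T) : exists g, (forall a, a \in s -> K a) ->
    [/\ K g, ~ sp s g & forall g', K g' -> ~ sp s g' -> (mu g <= mu g')%N].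
  have [Ks|nKs] := pselect (forall a, a \in s -> K a); last by exists g0 => /nKs.
  have [g [Kg spg]] := Ksp s Ks.
  have [|m /asboolP[h [Kh sph mh]] mmin] :=
    @ex_minnP (fun m => `[< exists h, [/\ K h, ~ sp s h & mu h = m] >]).
    by exists (mu g); apply/asboolP; exists g.
  exists h => _; split=> // g' Kg' spg'; rewrite mh; apply: mmin.
  by apply/asboolP; exists g'.
pose fix L n := if n is m.+1 then rcons (L m) (next (L m)) else [::].
exists (next \o L) => n.
have -> : mkseq (next \o L) n = L n.
  by elim: n => // n IHn; rewrite /mkseq -addn1 iotaD map_cat -/(mkseq _ n) IHn addn1 /= cats1.
apply: (nextP _); elim: n => [|n IHn] //= a.
by rewrite mem_rcons inE => /orP[/eqP->|/IHn //]; have [] := nextP _ IHn.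
Qed.

Definition subring_set (R : comPzRingType) (B : set R) : Prop :=
  [/\ B 1, forall a b, B a -> B b -> B (a - b) &
      forall a b, B a -> B b -> B (a * b)].

Definition span_over (R : comPzRingType) (B : set R) (s : seq R) : set R :=
  [set a | exists c : nat -> R,
    (forall i, B (c i)) /\ a = \sum_(i < size s) c i * s`_i].

(** The ascending chain condition for ideals of the subring [B], in the form
    that survives adjoining an element most easily: no sequence can keep leaving
    the ideals generated by its previous terms. *)
Definition noetherian (R : comPzRingType) (B : set R) : Prop :=
  forall f : nat -> R, (forall n, B (f n)) ->
    exists n, span_over B (mkseq f n) (f n).

Section Span.
Variables (R : comPzRingType) (B : set R).
Hypothesis subB : subring_set B.
Implicit Types (s : seq R) (a b : R).

Lemma subring0 : B 0.
Proof. by have [B1 BB _] := subB; rewrite -(subrr 1); apply: BB. Qed.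

Lemma subringN a : B a -> B (- a).
Proof. by have [_ BB _] := subB; rewrite -sub0r; apply/BB/subring0. Qed.

Lemma subringD a b : B a -> B b -> B (a + b).
Proof.
by move=> Ba Bb; rewrite -(opprK b); have [_ BB _] := subB; apply/BB/subringN.
Qed.

Lemma subringM a b : B a -> B b -> B (a * b).
Proof. by have [_ _] := subB; apply. Qed.

Lemma subring_sum (J : Type) (s : seq J) (P : pred J) (F : J -> R) :
  (forall j, P j -> B (F j)) -> B (\sum_(j <- s | P j) F j).
Proof. by move=> BF; apply: big_ind => //; [exact: subring0 | exact: subringD]. Qed.

Lemma span0 s : span_over B s 0.
Proof.
exists (fun=> 0); split=> [_|]; first exact: subring0.
by rewrite big1 // => i _; rewrite mul0r.
Qed.

Lemma spanD s a b : span_over B s a -> span_over B s b -> span_over B s (a + b).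
Proof.
move=> [c [Bc ->]] [c' [Bc' ->]]; exists (fun i => c i + c' i).
split=> [i|]; first exact: subringD.
by rewrite -big_split; apply: eq_bigr => i _; rewrite mulrDl.
Qed.

Lemma spanM s a b : B a -> span_over B s b -> span_over B s (a * b).
Proof.
move=> Ba [c [Bc ->]]; exists (fun i => a * c i).
split=> [i|]; first exact: subringM.
by rewrite mulr_sumr; apply: eq_bigr => i _; rewrite mulrA.
Qed.

Lemma span_sum s (J : Type) (t : seq J) (P : pred J) (F : J -> R) :
  (forall j, P j -> span_over B s (F j)) -> span_over B s (\sum_(j <- t | P j) F j).
Proof. by move=> BF; apply: big_ind => //; [exact: span0 | exact: spanD]. Qed.

Lemma span_mem s a : a \in s -> span_over B s a.
Proof.
have [B1 _ _] := subB.
move=> /(nthP 0)[i si <-]; exists (fun j => (j == i)%:R); split=> [j|].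
  by case: eqP => _ //; apply: subring0.
rewrite (bigD1 (Ordinal si)) //= eqxx mul1r big1 ?addr0 // => j.
by rewrite -(inj_eq val_inj) /= => /negPf ->; rewrite mul0r.
Qed.

Lemma span_trans s s' : (forall a, a \in s -> span_over B s' a) -> span_over B s `<=` span_over B s'.
Proof.
move=> ss' _ [c [Bc ->]]; apply: span_sum => i _; apply: spanM => //.
by apply: ss'; apply: mem_nth.
Qed.

Lemma span_mkseqS (f : nat -> R) m n : (m <= n)%N ->
  span_over B (mkseq f m) `<=` span_over B (mkseq f n).
Proof.
move=> mn; apply: span_trans => a /mapP[i]; rewrite mem_iota /= add0n => im ->.
by apply/span_mem/map_f; rewrite mem_iota /= add0n (leq_trans im mn).
Qed.

Lemma noetherian_fg (K : set R) : noetherian B -> K `<=` B ->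
  exists s, (forall a, a \in s -> K a) /\ K `<=` span_over B s.
Proof.
move=> nB KB; apply: contrapT => nfg.
have [s Ks|f fP] := @greedy_sequence R K (span_over B) (fun=> 0%N).
  apply: contrapT => ns; apply: nfg; exists s; split=> // a Ka.
  by apply: contrapT => sa; apply: ns; exists a.
have [n spn] := nB f (fun n => let: And3 Kf _ _ := fP n in KB _ Kf).
by have [] := fP n.
Qed.

End Span.

Section HilbertBasis.
Variables (R : comNzRingType) (B : set R).
Hypothesis subB : subring_set B.

Definition poly_over : set {poly R} := [set p | forall i, B p`_i].

Lemma poly_over_subring : subring_set poly_over.
Proof.
have [B1 BB _] := subB; split=> [i|p q Bp Bq i|p q Bp Bq i].
- by rewrite coef1; case: eqP => _ //; apply: subring0.
- by rewrite coefB; apply: BB.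
by rewrite coefM; apply: subring_sum => // j _; apply: subringM.
Qed.

(** Hilbert's argument: in a sequence of polynomials of least degree outside the
    ideal generated by the previous ones, a relation between the leading
    coefficients would give a polynomial of smaller degree. *)
Lemma noetherian_poly : noetherian B -> noetherian poly_over.
Proof.
move=> nB f Bf; have subX := poly_over_subring.
apply: contrapT => /forallNP nf.
pose K : set {poly R} := [set p | exists n, span_over poly_over (mkseq f n) p].
have Kfin (s : seq {poly R}) : (forall p, p \in s -> K p) ->
    exists m, forall p, p \in s -> span_over poly_over (mkseq f m) p.
  elim: s => [|p s IHs] Ks; first by exists 0%N.
  have [|m Hm] := IHs; first by move=> q qs; apply: Ks; rewrite inE qs orbT.
  have [n Hn] := Ks p (mem_head _ _); exists (maxn m n) => q.
  rewrite inE => /orP[/eqP->|/Hm]; last exact: (span_mkseqS subX (leq_maxl m n)).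
  exact: (span_mkseqS subX (leq_maxr m n) Hn).
have [s /Kfin[m Hm]|g gP] := @greedy_sequence _ K (span_over poly_over) (fun p : {poly R} => size p).
  exists (f m); split; last by move=> /(span_trans subX Hm)/(nf m).
  by exists m.+1; apply: (span_mem subX); apply: map_f; rewrite mem_iota /= add0n.
have Kg n : K (g n) by have [] := gP n.
have ng n : ~ span_over poly_over (mkseq g n) (g n) by have [] := gP n.
have Bg n : poly_over (g n).
  have [m [c [Bc ->]]] := Kg n; apply: (subring_sum subX) => i _.
  apply: (subringM subX) => //; rewrite size_mkseq in i *.
  by rewrite nth_mkseq.
have g0 n : (0 < size (g n))%N.
  by rewrite size_poly_gt0; apply: contra_notN (ng n) => /eqP->; apply: (span0 subX).
have [n [c [Bc lcE]]] := nB (fun n => lead_coef (g n)) (fun n => Bg n _).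
rewrite size_mkseq in lcE.
have sg i : (i < n)%N -> (size (g i) <= size (g n))%N.
  move=> i_n; have [_ _] := gP i; apply; first exact: Kg.
  by move=> /(span_mkseqS subX (ltnW i_n))/ng.
pose q i := (c i)%:P * 'X^(size (g n) - size (g i)).
have Bq i : poly_over (q i).
  by move=> j; rewrite coefMXn coefC; do 2?case: ifP => _ //; apply: subring0.
pose h := g n - \sum_(i < n) q i * g i.
have nh : ~ span_over poly_over (mkseq g n) h.
  move=> sh; apply: (ng n); rewrite -(subrK (\sum_(i < n) q i * g i) (g n)).
  apply: (spanD subX) => //; exists q; split=> //; rewrite size_mkseq.
  by apply: eq_bigr => i _; rewrite nth_mkseq.
have Kh : K h.
  have [m Hm] : exists m, forall p, p \in mkseq g n.+1 -> span_over poly_over (mkseq f m) p.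
    by apply: Kfin => p /mapP[i _ ->].
  have Hg i : (i <= n)%N -> span_over poly_over (mkseq f m) (g i).
    by move=> i_n; apply: Hm; apply: map_f; rewrite mem_iota /= add0n.
  exists m; apply: (spanD subX); first exact: Hg.
  rewrite -mulN1r; apply: (spanM subX); first by apply: (subringN subX); have [] := subX.
  apply: (span_sum subX) => i _; apply: (spanM subX) => //.
  by apply: Hg; apply: ltnW.
have [_ _ /(_ h Kh nh)] := gP n; apply/negP; rewrite -ltnNge.
rewrite -[X in (_ < X)%N](prednK (g0 n)) ltnS; apply/leq_sizeP => j.
have coefq i : (i < n)%N -> ((size (g n)).-1 <= j)%N ->
    (q i * g i)`_j = c i * (g i)`_(j - (size (g n) - size (g i))).
  move=> /sg sin jn; rewrite -mulrA coefCM coefXnM.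
  by have := g0 i; have := g0 n; case: ifP => //; lia.
rewrite leq_eqVlt => /orP[/eqP jE|]; rewrite coefB coef_sum.
  rewrite -jE -/(lead_coef _) lcE; apply/eqP; rewrite subr_eq0; apply/eqP.
  apply: eq_bigr => i _; rewrite nth_mkseq // jE coefq -?jE // lead_coefE.
  by congr (_ * _`_ _); have := g0 i; have := g0 n; have := sg i (ltn_ord i); lia.
rewrite prednK // => nj; rewrite nth_default // sub0r big1 ?oppr0 // => i _.
rewrite coefq //; last by lia.
have aux (a b l : nat) : (a <= b)%N -> (b <= l)%N -> (a <= l - (b - a))%N by lia.
by rewrite nth_default ?mulr0 //; apply: aux nj; apply: sg.
Qed.

Definition adjoin (a : R) : set R := [set p.[a] | p in poly_over].

Lemma adjoin_subring a : subring_set (adjoin a).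
Proof.
have [X1 XB XM] := poly_over_subring; split.
- by exists 1; rewrite ?hornerC.
- by move=> _ _ [p Bp <-] [q Bq <-]; exists (p - q); [apply: XB | rewrite hornerD hornerN].
by move=> _ _ [p Bp <-] [q Bq <-]; exists (p * q); [apply: XM | rewrite hornerM].
Qed.

Lemma sub_adjoin a : B `<=` adjoin a.
Proof.
move=> b Bb; exists b%:P; last by rewrite hornerC.
by move=> i; rewrite coefC; case: eqP => _ //; apply: subring0.
Qed.

Lemma mem_adjoin a : adjoin a a.
Proof.
exists 'X; last by rewrite hornerX.
by move=> i; rewrite coefX; case: eqP => _; [have [] := subB | apply: subring0].
Qed.

Lemma noetherian_adjoin a : noetherian B -> noetherian (adjoin a).
Proof.
move=> /noetherian_poly nX f /(_ _)/cid2 p.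
have [n [c [Bc pE]]] := nX (fun n => s2val (p n)) (fun n => s2valP (p n)).
exists n, (fun i => (c i).[a]); split=> [i|]; first by exists (c i).
rewrite -{1}(s2valP' (p n)) pE horner_sum !size_mkseq; apply: eq_bigr => i _.
by rewrite !nth_mkseq // hornerM (s2valP' (p i)).
Qed.

End HilbertBasis.

Section AdjoinSeq.
Variables (R : comNzRingType) (B : set R).
Hypothesis subB : subring_set B.

Definition adjoin_seq (s : seq R) : set R := foldr (fun a C => adjoin C a) B s.

Lemma adjoin_seq_subring s : subring_set (adjoin_seq s).
Proof. by elim: s => [|a s IHs] //=; apply: adjoin_subring. Qed.

Lemma sub_adjoin_seq s : B `<=` adjoin_seq s.
Proof.
elim: s => [|a s IHs] // b /IHs; apply: sub_adjoin; exact: adjoin_seq_subring.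
Qed.

Lemma mem_adjoin_seq s a : a \in s -> adjoin_seq s a.
Proof.
elim: s => [|b s IHs] //; rewrite inE => /orP[/eqP->|/IHs].
  by apply: mem_adjoin; apply: adjoin_seq_subring.
by apply: sub_adjoin; apply: adjoin_seq_subring.
Qed.

Lemma noetherian_adjoin_seq s : noetherian B -> noetherian (adjoin_seq s).
Proof.
move=> nB; elim: s => [|a s IHs] //=; apply: noetherian_adjoin => //.
exact: adjoin_seq_subring.
Qed.

Lemma adjoin_seq_min (D : set R) s : subring_set D -> B `<=` D ->
  (forall a, a \in s -> D a) -> adjoin_seq s `<=` D.
Proof.
move=> subD BD; elim: s => [|a s IHs] // Ds _ [p Bp <-].
have Dp i : D p`_i.
  by apply: IHs (Bp i) => b bs; apply: Ds; rewrite inE bs orbT.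
rewrite horner_coef; apply: (subring_sum subD) => i _.
apply: (subringM subD) => //; elim: (nat_of_ord i) => [|m IHm].
  by have [] := subD.
by rewrite exprS; apply: (subringM subD) => //; apply: Ds; rewrite mem_head.
Qed.

End AdjoinSeq.

Section AlgebraOverField.
Variables (k : fieldType) (A : comAlgType k).

Definition scalars : set A := [set c%:A | c in [set: k]].

Lemma scalars_subring : subring_set scalars.
Proof.
split; first by exists 1; rewrite ?scale1r.
- by move=> _ _ [a _ <-] [b _ <-]; exists (a - b); rewrite ?scalerBl.
by move=> _ _ [a _ <-] [b _ <-]; exists (a * b); rewrite // -scalerAl mul1r scalerA.
Qed.

Lemma noetherian_scalars : noetherian scalars.
Proof.
move=> f Bf; have /choice[c fE] n : exists c : k, f n = c%:A.
  by have [c _ <-] := Bf n; exists c.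
have [c0|c0] := eqVneq (c 0%N) 0.
  exists 0%N, (fun=> 0); split=> [_|]; first exact: (subring0 scalars_subring).
  by rewrite big_ord0 fE c0 scale0r.
exists 1%N, (fun=> (c 1%N / c 0%N)%:A); split=> [_|]; first by exists (c 1%N / c 0%N).
by rewrite big_ord1 /= !fE -scalerAl mul1r scalerA divfK.
Qed.

Lemma standard_graded_noetherian (gr : nat -> set A) :
  standard_graded gr -> noetherian [set: A].
Proof.
move=> [_ _ [r [g [_ gen]]]].
have subS := adjoin_seq_subring scalars_subring (codom g).
have <- : adjoin_seq scalars (codom g) = setT.
  apply: gen.
  - by move=> c; apply: (sub_adjoin_seq scalars_subring); exists c.
  - by move=> a b; apply: (subringD subS).
  - by move=> a b; apply: (subringM subS).
  by move=> j; apply: (mem_adjoin_seq scalars_subring); apply: codom_f.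
exact: (noetherian_adjoin_seq scalars_subring noetherian_scalars).
Qed.

Lemma ideal_gen_finite (G : set A) : noetherian [set: A] ->
  exists q (h : 'I_q -> A), (forall j, G (h j)) /\ ideal_gen G = ideal_gen (range h).
Proof.
move=> nA; have [s [sG Gs]] := noetherian_fg nA (@subsetT _ G).
exists (size s), (fun j => s`_j); split=> [j|]; first by apply/sG/mem_nth.
apply/seteqP; split; last by apply: ideal_genS => _ [j _ <-]; apply/sG/mem_nth.
apply: ideal_gen_min; first exact: ideal_gen_ideal.
move=> _ /Gs[c [_ ->]]; apply: ideal_sum => [|j _]; first exact: ideal_gen_ideal.
apply: (idealM _ (ideal_gen_ideal _)); apply: sub_ideal_gen; by exists j.
Qed.

End AlgebraOverField.

(** * Products of homogeneous ideals *)

Section HomogeneousProducts.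
Variables (R : comPzRingType) (gr : nat -> set R) (grP : grading gr).
Implicit Types (P K L I : set R) (a : R).

Lemma homogeneous_mul K L : homogeneous grP K -> homogeneous grP L ->
  homogeneous grP (ideal_mul K L).
Proof.
move=> [iK hK] [iL hL]; have iKL := ideal_mul_ideal K L; split=> // a KLa i.
suff : forall j, ideal_mul K L (hcomp grP a j) by apply.
move: a KLa; apply: ideal_mul_min.
  split=> [j|a b Ka Kb j|c a Ka j].
  - by rewrite hcomp0; apply: ideal0.
  - by rewrite hcompD; apply: (idealD iKL (Ka j) (Kb j)).
  have [N ->] := hcomp_sumE grP c; rewrite mulr_suml hcomp_sum; apply: ideal_sum => // l _.
  rewrite (hcompM grP _ _ (hcomp_gr grP c l)); case: ifP => _; last exact: ideal0.
  exact: (idealM _ iKL (Ka _)).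
move=> a b Ka Lb j; have [N ->] := hcomp_sumE grP a.
rewrite mulr_suml hcomp_sum; apply: ideal_sum => // l _.
rewrite (hcompM grP _ _ (hcomp_gr grP a l)); case: ifP => _; last exact: ideal0.
by apply: ideal_mulP; [apply: hK | apply: hL].
Qed.

Lemma homogeneous_pow I n : homogeneous grP I -> homogeneous grP (ideal_pow I n).
Proof. by move=> hI; elim: n => [|n IHn] //; apply: homogeneous_mul. Qed.

End HomogeneousProducts.

Section HomogeneousCofactors.
Variables (R : comPzRingType) (gr : nat -> set R) (grP : grading gr).

(** Components of degree [m] of arbitrary cofactors; a generator of degree greater
    than [m] does not contribute. *)
Lemma ideal_mul_range_hom r (y : 'I_r -> R) (e : 'I_r -> nat) P m a :
  (forall j, gr (e j) (y j)) -> homogeneous grP P -> gr m a ->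
  ideal_mul (ideal_gen (range y)) P a ->
  exists b : 'I_r -> R, [/\ forall j, P (b j),
    forall j, (e j <= m)%N -> gr (m - e j)%N (b j) &
    a = \sum_(j | (e j <= m)%N) y j * b j].
Proof.
move=> gy [iP hP] ga /(ideal_mul_rangeP iP)[b [Pb aE]].
exists (fun j => hcomp grP (b j) (m - e j)); split=> [j|j _|].
- exact: hP.
- exact: hcomp_gr.
have := congr1 (fun a => hcomp grP a m) aE; rewrite (hcomp_hom grP _ ga) eqxx => ->.
rewrite hcomp_sum [RHS]big_mkcond; apply: eq_bigr => j _.
exact: hcompM.
Qed.

End HomogeneousCofactors.

(** * Superficial elements modulo an ideal *)

Section QuotientPowers.
Variables (R : comPzRingType) (S : set R).

Lemma to_quot0 : to_quot S 0 = 0.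
Proof. by apply: (addrI (to_quot S 0)); rewrite -to_quotD !addr0. Qed.

Lemma image_to_quot_ideal K : is_ideal K -> is_ideal (@to_quot R S @` K).
Proof.
move=> iK; split.
- by exists 0; [exact: ideal0 | exact: to_quot0].
- move=> _ _ [a Ka <-] [b Kb <-]; exists (a + b); first exact: idealD.
  by rewrite to_quotD.
move=> c _ [a Ka <-]; have [c' ->] := to_quot_surj c; exists (c' * a).
  exact: idealM.
by rewrite -to_quotM.
Qed.

Lemma ideal_pow_to_quot I n :
  ideal_pow (@to_quot R S @` I) n = @to_quot R S @` ideal_pow I n.
Proof.
elim: n => [|n IHn].
  by apply/seteqP; split=> // a _; have [a' ->] := to_quot_surj a; exists a'.
rewrite /= IHn; apply/seteqP; split.
  apply: ideal_mul_min; first by apply: image_to_quot_ideal; apply: ideal_mul_ideal.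
  by move=> _ _ [a Ia <-] [b Ib <-]; exists (a * b); [apply: ideal_mulP | rewrite -to_quotM].
set J := (X in _ `<=` X); have iJ : is_ideal J by apply: ideal_mul_ideal.
move=> _ [a Ia <-]; move: a Ia; apply: ideal_mul_min.
  split.
  - by rewrite to_quot0; exact: (ideal0 iJ).
  - by move=> a b Ja Jb; rewrite to_quotD; apply: (idealD iJ Ja Jb).
  by move=> c a Ja; rewrite -to_quotM; apply: (idealM (to_quot S c) iJ Ja).
move=> a b Ia Ib; rewrite -to_quotM; apply: ideal_mulP; first by exists a.
by exists b.
Qed.

(** Powers of the image of [I] are images of the powers of [I], so that
    superficiality modulo [S] can be used on representatives. *)
Lemma superficial_lift (I : set R) (x : R) : is_ideal S ->
  superficial (@to_quot R S @` I) (to_quot S x) ->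
  exists c N, forall n, (N <= n)%N -> forall b w, ideal_pow I c b ->
    ideal_pow I n.+1 w -> S (b * x - w) ->
    exists2 w', ideal_pow I n w' & S (b - w').
Proof.
move=> iS [_ [c [N sup]]]; exists c, N => n Nn b w Ib Iw Sw.
have toS a a' : S (a - a') <-> to_quot S a = to_quot S a'.
  by rewrite -[X in X _ <-> _](ideal_gen_id iS); split => /to_quot_eq.
have [w' Iw' /esym/toS Sw'] : (@to_quot R S @` ideal_pow I n) (to_quot S b).
  rewrite -ideal_pow_to_quot -(sup n Nn) !ideal_pow_to_quot; split; last by exists b.
  exists w => //; rewrite -[_ * _]/(quot_mul (to_quot S b) (to_quot S x)) to_quotM.
  by apply/esym/toS.
by exists w'.
Qed.

End QuotientPowers.

(** * Colon ideals of a superficial sequence in high degrees *)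

Section EquigeneratedIdeal.
Variables (k : fieldType) (A : comAlgType k) (gr : nat -> set A).
Hypothesis grP : grading gr.
Hypothesis gr0E : gr 0%N = [set c%:A | c in [set: k]].
Variables (d q : nat) (h : 'I_q -> A).
Hypothesis d_gt0 : (0 < d)%N.
Hypothesis gh : forall j, gr d (h j).

Let I : set A := ideal_gen (range h).

Lemma equigen_homogeneous : homogeneous grP I.
Proof. by apply: homogeneous_gen => _ [j _ <-]; exists d. Qed.

Lemma equigen_pow_homogeneous n : homogeneous grP (ideal_pow I n).
Proof. exact: (homogeneous_pow n equigen_homogeneous). Qed.

Lemma equigen_pow_low n a j : ideal_pow I n a -> (j < n * d)%N -> hcomp grP a j = 0.
Proof.
elim: n a j => [|n IHn] a j //.
move=> /(ideal_mul_rangeP (ideal_pow_ideal I n))[b [Ib ->]] jn.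
rewrite hcomp_sum big1 // => i _; rewrite (hcompM grP _ _ (gh i)).
case: ifP => // dj; rewrite IHn ?mulr0 //; lia.
Qed.

(** The degree [n] component of [k[I_d]], and so, up to isomorphism, of the fiber
    ring. *)
Definition fiber_piece n : set A := ideal_pow I n `&` gr (n * d)%N.
Notation E := fiber_piece.

Lemma fiber_pieceS n a : E n.+1 a ->
  exists b : 'I_q -> A, (forall j, E n (b j)) /\ a = \sum_j h j * b j.
Proof.
move=> [Ia ga].
have [b [Ib gb aE]] :=
  ideal_mul_range_hom (e := fun=> d) gh (equigen_pow_homogeneous n) ga Ia.
have dn : (d <= n.+1 * d)%N by rewrite mulSn leq_addr.
exists b; split=> [j|]; last by rewrite aE; apply: eq_bigl => j; rewrite dn.
by split=> //; have := gb j dn; rewrite mulSn addKn.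
Qed.

Lemma fiber_pieceM m n a b : E m a -> E n b -> E (m + n) (a * b).
Proof.
by move=> [Ia ga] [Ib gb]; split; [apply: ideal_mul_closed | rewrite mulnDl; apply: grM].
Qed.

(** The subalgebra [k[I_d]]. *)
Let B := adjoin_seq (@scalars k A) (codom h).

Lemma fiber_piece_subalgebra n : E n `<=` B.
Proof.
have subB := adjoin_seq_subring (@scalars_subring k A) (codom h).
elim: n => [|n IHn] a.
  move=> [_]; rewrite mul0n gr0E => ga.
  exact: (sub_adjoin_seq (@scalars_subring k A)).
move=> /fiber_pieceS[b [Eb ->]]; apply: (subring_sum subB) => j _.
apply: (subringM subB); last exact: IHn.
by apply: (mem_adjoin_seq (@scalars_subring k A)); apply: codom_f.
Qed.

(** The elements with this property form a subring, by comparison of degrees. *)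
Lemma subalgebra_hcomp f m : B f ->
  if (d %| m)%N then ideal_pow I (m %/ d) (hcomp grP f m) else hcomp grP f m = 0.
Proof.
pose D : set A := [set f | forall m,
  if (d %| m)%N then ideal_pow I (m %/ d) (hcomp grP f m) else hcomp grP f m = 0].
suff : B `<=` D by move=> BD /BD; apply.
have D0 a n : E n a -> D a.
  move=> [Ia ga] l; rewrite (hcomp_hom grP _ ga).
  case: (l =P (n * d)%N) => [->|_]; first by rewrite dvdn_mull // mulnK.
  by case: ifP => // _; apply: ideal0; apply: ideal_pow_ideal.
apply: adjoin_seq_min.
- split.
  + apply: (D0 _ 0%N); split=> //; exact: gr1.
  + move=> a b Da Db l; rewrite hcompB; have := Da l; have := Db l.
    case: ifP => _; last by move=> -> ->; rewrite subr0.
    by move=> ? ?; apply: idealB => //; apply: ideal_pow_ideal.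
  move=> a b Da Db l; have [N ->] := hcomp_sumE grP a.
  rewrite mulr_suml hcomp_sum.
  have term (i : 'I_N) : if (d %| l)%N
      then ideal_pow I (l %/ d) (hcomp grP (hcomp grP a i * b) l)
      else hcomp grP (hcomp grP a i * b) l = 0.
    have p0 := ideal0 (ideal_pow_ideal I (l %/ d)).
    rewrite (hcompM grP _ _ (hcomp_gr grP a i)); case: (leqP i l) => il; last by case: ifP.
    have := Da i; case: ifP => di; last by move=> ->; rewrite mul0r; case: ifP.
    have := Db (l - i)%N; rewrite (dvdn_subl il di); case: ifP => dl; last first.
      by move=> ->; rewrite mulr0.
    move=> Ib Ia; have := ideal_mul_closed Ia Ib.
    by rewrite -divnDl // subnKC.
  case: ifP term => _ term; last by rewrite big1.
  by apply: ideal_sum => // ; apply: ideal_pow_ideal.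
- by move=> a sa; apply: (D0 _ 0%N); split=> //; rewrite mul0n gr0E.
move=> _ /codomP[j ->]; apply: (D0 _ 1%N); split; last by rewrite mul1n.
rewrite /= -[h j]mulr1; apply: ideal_mulP => //.
by apply: sub_ideal_gen; exists j.
Qed.

Variables (s : nat) (x : nat -> A).
Hypothesis xI : forall i, I (x i).
Hypothesis gx : forall i, exists e, gr e (x i).

Definition before i : set A := ideal_gen (range (fun j : 'I_i => x j)).

Lemma before_ideal i : is_ideal (before i). Proof. exact: ideal_gen_ideal. Qed.

Lemma before_homogeneous i : homogeneous grP (before i).
Proof. by apply: homogeneous_gen => _ [j _ <-]; apply: gx. Qed.

Lemma before_mem i j : (j < i)%N -> before i (x j).
Proof. by move=> ji; apply: sub_ideal_gen; exists (Ordinal ji). Qed.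

Lemma before_sub i j : (i <= j)%N -> before i `<=` before j.
Proof.
move=> ij; apply: ideal_gen_min; first exact: before_ideal.
by move=> _ [l _ <-]; apply: before_mem; apply: leq_trans ij.
Qed.

Lemma before_subI i : before i `<=` I.
Proof. by apply: ideal_gen_min; [exact: ideal_gen_ideal | move=> _ [j _ <-]]. Qed.

Lemma beforeS i a : before i.+1 a -> exists c, before i (a - x i * c).
Proof.
move=> /ideal_gen_rangeP[b ->]; exists (b ord_max).
rewrite big_ord_recr /= mulrC addrK; apply: ideal_sum => [|j _].
  exact: before_ideal.
by apply: (idealM _ (before_ideal i)); apply: before_mem; exact: ltn_ord.
Qed.

(** An Artin-Rees lemma. The contraction of [(x_0, ..., x_i)] to the Noetherian ring
    [k[I_d]] has finitely many generators; an element of high degree is a combination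
    of them with coefficients of high degree, that is in a high power of [I]. *)
Lemma artin_rees i c : exists N, forall n, (N <= n)%N -> forall a,
  E n.+1 a -> before i.+1 a ->
  exists2 b, ideal_pow I c b & before i (a - x i * b).
Proof.
have subK := @scalars_subring k A.
have nB : noetherian B := noetherian_adjoin_seq subK (@noetherian_scalars k A).
have [gs [gsK gsP]] := noetherian_fg nB (K := B `&` before i.+1) (@subIsetl _ _ _).
have hb := before_homogeneous i.+1; have bi := before_ideal i.
have iI n : is_ideal (ideal_pow I n) := ideal_pow_ideal I n.
have [N NP] : exists N, forall l, (l < size gs)%N -> gs`_l = \sum_(j < N) hcomp grP gs`_l j.
  have [N NP] : exists N, forall l : 'I_(size gs), forall M, (N <= M)%N ->
      gs`_l = \sum_(j < M) hcomp grP gs`_l j.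
    apply: uniform_bound => [l M M' MM' H M'' ?|l]; first by apply: H; lia.
    have [_ [M [M0 ME]]] := hcompP grP gs`_l; exists M => M' MM'.
    by rewrite (sum_widen MM' M0).
  by exists N => l ls; apply: (NP (Ordinal ls)).
exists (N + c)%N => n Nn a Ea ba.
have [f [Bf aE]] : span_over B gs a by apply: gsP; split=> //; apply: fiber_piece_subalgebra Ea.
set D := (n.+1 * d)%N.
have {}aE : a = \sum_(l < size gs) \sum_(j < N)
    hcomp grP (hcomp grP gs`_l j * f l) D.
  have [_ ga] := Ea.
  have := congr1 (fun a => hcomp grP a D) aE; rewrite (hcomp_hom grP _ ga) eqxx => ->.
  rewrite hcomp_sum; apply: eq_bigr => l _.
  by rewrite -hcomp_sum -mulr_suml -NP // mulrC.
have term (l : 'I_(size gs)) (j : 'I_N) : exists b, ideal_pow I c b /\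
    before i (hcomp grP (hcomp grP gs`_l j * f l) D - x i * b).
  rewrite (hcompM grP _ _ (hcomp_gr grP _ j)); case: ifP => jD; last first.
    by exists 0; rewrite mulr0 subr0; split; apply: ideal0.
  have bl : before i.+1 gs`_l by have [] := gsK _ (mem_nth 0 (ltn_ord l)).
  have [c' bc'] := beforeS (hb.2 _ bl j).
  exists (c' * hcomp grP (f l) (D - j)); split; last first.
    by rewrite mulrA -mulrBl mulrC; apply: (idealM _ bi).
  apply: (idealM _ (iI c)).
  have := subalgebra_hcomp (D - j) (Bf l); case: ifP => [dj|_ ->]; last exact: (ideal0 (iI c)).
  apply: ideal_pow_le; rewrite leq_divRL //.
  have := ltn_ord j; rewrite /D; nia.
have /choice[b bP] (l : 'I_(size gs)) : exists b : 'I_N -> A, forall j, ideal_pow I c (b j) /\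
    before i (hcomp grP (hcomp grP gs`_l j * f l) D - x i * b j).
  by have [b bP] := choice (term l); exists b.
exists (\sum_(l < size gs) \sum_(j < N) b l j).
  by apply: (ideal_sum _ (iI c)) => l _; apply: (ideal_sum _ (iI c)) => j _;
    have [] := bP l j.
rewrite aE mulr_sumr -sumrB; apply: (ideal_sum _ bi) => l _.
rewrite mulr_sumr -sumrB; apply: (ideal_sum _ bi) => j _; by have [] := bP l j.
Qed.

Hypothesis sup : forall i, (i < s)%N -> exists c N, forall n, (N <= n)%N ->
  forall b w, ideal_pow I c b -> ideal_pow I n.+1 w -> before i (b * x i - w) ->
  exists2 w', ideal_pow I n w' & before i (b - w').

(** Superficiality only speaks about cofactors in a fixed power [I ^ c], and
    [artin_rees] provides such a cofactor of [x i]. *)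
Lemma before_cap_pow i : (i <= s)%N -> exists N, forall n, (N <= n)%N ->
  forall a, E n.+1 a -> before i a -> ideal_mul (before i) (ideal_pow I n) a.
Proof.
elim: i => [_|i IHi si].
  exists 0%N => n _ a _ /ideal_gen_rangeP[b ->]; rewrite big_ord0.
  exact: (ideal0 (ideal_mul_ideal _ _)).
have [N0 HN0] := IHi (ltnW si); have [c [N1 HN1]] := sup si.
have [N2 HN2] := artin_rees i c.
exists (N0 + N1 + N2)%N => n Nn a Ea ba.
have n0N : (N0 <= n)%N by lia.
have n1N : (N1 <= n)%N by lia.
have n2N : (N2 <= n)%N by lia.
have [b Ib bb] := HN2 n n2N a Ea ba.
have [Ia ga] := Ea; have bi := before_ideal i.
have [|w Iw bw] := HN1 n n1N b a Ib Ia.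
  by rewrite -opprB mulrC; apply: (idealN bi).
have [e ge] := gx i.
have iP := ideal_mul_ideal (before i.+1) (ideal_pow I n).
have Ixw : ideal_pow I n.+1 (x i * w) by apply: ideal_mulP.
pose a' := hcomp grP (a - x i * w) (n.+1 * d).
have -> : a = a' + hcomp grP (x i * w) (n.+1 * d).
  by rewrite /a' hcompB (hcomp_hom grP _ ga) eqxx subrK.
apply: (idealD iP).
  apply: (ideal_mulS (before_sub (leqnSn i)) (@subset_refl _ _)).
  apply: HN0 => //.
    split; last exact: hcomp_gr.
    apply: (equigen_pow_homogeneous n.+1).2; exact: (idealB (ideal_pow_ideal I n.+1) Ia Ixw).
  apply: (before_homogeneous i).2.
  rewrite (_ : a - x i * w = (a - x i * b) + x i * (b - w)); last by ring.
  exact: (idealD bi bb (idealM (x i) bi bw)).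
rewrite (hcompM grP _ _ ge); case: ifP => _; last exact: (ideal0 iP).
by apply: ideal_mulP; [apply: before_mem | apply: (equigen_pow_homogeneous n).2].
Qed.

(** By superficiality [a] lies in [I ^ m + before i] for all large [m], hence in
    [before i] because [I ^ m] starts in degree [m d]. *)
Lemma colon_large i : (i < s)%N -> exists N, forall n, (N <= n)%N ->
  forall a, E n.+1 a -> before i (a * x i) ->
  ideal_mul (before i) (ideal_pow I n) a.
Proof.
move=> si; have [N0 HN0] := before_cap_pow (ltnW si); have [c [N1 HN1]] := sup si.
exists (N0 + c)%N => n Nn a Ea bax; apply: HN0 => //; first by lia.
have [Ia ga] := Ea.
have Ica : ideal_pow I c a by apply: ideal_pow_le Ia; lia.
have [||w Iw] := HN1 (N1 + n.+2)%N (leq_addr _ _) a 0 Ica.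
- exact: (ideal0 (ideal_pow_ideal I (N1 + n.+2).+1)).
- by rewrite subr0.
move=> /((before_homogeneous i).2 _)/(_ (n.+1 * d)%N).
rewrite hcompB (hcomp_hom grP _ ga) eqxx (equigen_pow_low Iw) ?subr0 //; nia.
Qed.

End EquigeneratedIdeal.

(** * The grading of the fiber ring *)

Section OrderIdeals.
Variables (R : comPzRingType) (gr : nat -> set R) (grP : grading gr).

Definition order_ge N : set R := [set a | forall j, (j < N)%N -> hcomp grP a j = 0].

Lemma order_ge_mul M N a b : order_ge M a -> order_ge N b -> order_ge (M + N) (a * b).
Proof.
move=> Ma Nb j jMN; have [L aE] := hcomp_sumE grP a; rewrite aE.
rewrite mulr_suml hcomp_sum big1 // => i _; rewrite (hcompM grP _ _ (hcomp_gr grP a i)).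
case: ifP => // ij; have [iM|Mi] := ltnP i M; first by rewrite Ma ?mul0r.
by rewrite Nb ?mulr0 //; lia.
Qed.

Lemma order_ge_ideal N : is_ideal (order_ge N).
Proof.
split=> [j _|a b Na Nb j jN|c a Na]; first by rewrite hcomp0.
  by rewrite hcompD Na // Nb // addr0.
by rewrite -[N]add0n; apply: order_ge_mul.
Qed.

Lemma irrelevant_order : irrelevant_ideal gr `<=` order_ge 1.
Proof.
apply: ideal_gen_min; first exact: order_ge_ideal.
move=> a [n n0 ga] j j1; rewrite (hcomp_hom grP _ ga); case: eqP => // jn.
by move: n0 j1; rewrite /= -jn; case: (j).
Qed.

End OrderIdeals.

Section ReesClasses.
Variables (A : comNzRingType) (gr : nat -> set A) (I : set A).

Notation F := (fiber_ring gr I).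
Notation mI n := (ideal_mul (irrelevant_ideal gr) (ideal_pow I n)).

Definition rees_mono n a : rees I := insubd (0 : rees I) (a *: 'X^n).

Lemma rees_mono_coef n a i : ideal_pow I n a ->
  (rees_val (rees_mono n a))`_i = if i == n then a else 0.
Proof.
move=> Ia; rewrite -[rees_val _]/(val (rees_mono n a)) val_insubd ifT.
  by rewrite coefZ coefXn; case: eqP; rewrite ?mulr1 ?mulr0.
apply/asboolP => j; rewrite coefZ coefXn; case: eqP => [->|_].
  by rewrite mulr1.
by rewrite mulr0; apply: (ideal0 (ideal_pow_ideal I j)).
Qed.

Lemma rees_eqP (p q : rees I) :
  (forall i, (rees_val p)`_i = (rees_val q)`_i) -> p = q.
Proof. by move=> pq; apply: val_inj; apply/polyP. Qed.

(** The class of [a t ^ n]; meaningful for [a] in [I ^ n] only, because [insubd] falls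
    back to zero. *)
Definition fiber_class n a : F := to_quot (fiber_ideal gr I) (rees_mono n a).

Lemma to_fiber_eq0 (p : rees I) :
  to_quot (fiber_ideal gr I) p = 0 :> F <-> forall n, mI n (rees_val p)`_n.
Proof.
rewrite -[X in _ = X]to_quot0 to_quot_eq subr0.
by rewrite (ideal_gen_id (fiber_ideal_ideal gr I)).
Qed.

Lemma fiber_class_eq0 n a : ideal_pow I n a -> fiber_class n a = 0 <-> mI n a.
Proof.
move=> Ia; rewrite to_fiber_eq0; split=> [/(_ n)|ma i].
  by rewrite rees_mono_coef // eqxx.
rewrite rees_mono_coef //; case: eqP => [->|_] //.
exact: (ideal0 (ideal_mul_ideal _ _)).
Qed.

Lemma fiber_classD n a b : ideal_pow I n a -> ideal_pow I n b ->
  fiber_class n (a + b) = fiber_class n a + fiber_class n b.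
Proof.
move=> Ia Ib; rewrite -to_quotD; congr to_quot; apply: rees_eqP => i.
rewrite [RHS]coefD !rees_mono_coef //; last exact: (idealD (ideal_pow_ideal I n)).
by case: eqP => // _; rewrite addr0.
Qed.

Lemma fiber_classN n a : ideal_pow I n a -> fiber_class n (- a) = - fiber_class n a.
Proof.
move=> Ia; have Na := idealN (ideal_pow_ideal I n) Ia.
apply/eqP; rewrite -addr_eq0 -fiber_classD // addNr.
apply/eqP/fiber_class_eq0; first exact: (ideal0 (ideal_pow_ideal I n)).
exact: (ideal0 (ideal_mul_ideal _ _)).
Qed.

Lemma fiber_classB n a b : ideal_pow I n a -> ideal_pow I n b ->
  fiber_class n (a - b) = fiber_class n a - fiber_class n b.
Proof.
move=> Ia Ib; rewrite fiber_classD ?fiber_classN //.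
exact: (idealN (ideal_pow_ideal I n)).
Qed.

Lemma fiber_classM m n a b : ideal_pow I m a -> ideal_pow I n b ->
  fiber_class m a * fiber_class n b = fiber_class (m + n) (a * b).
Proof.
move=> Ia Ib; rewrite -[LHS]/(quot_mul _ _) to_quotM; congr to_quot.
apply: rees_eqP => i; rewrite rees_mono_coef; last exact: ideal_mul_closed.
rewrite -[rees_val _]/(rees_val (rees_mono m a) * rees_val (rees_mono n b)).
have E l c : ideal_pow I l c -> rees_val (rees_mono l c) = c *: 'X^l.
  move=> Ic; apply/polyP => j; rewrite rees_mono_coef // coefZ coefXn.
  by case: eqP; rewrite ?mulr1 ?mulr0.
rewrite !E // -scalerAl -scalerAr scalerA -exprD coefZ coefXn.
by case: eqP; rewrite ?mulr1 ?mulr0.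
Qed.

Lemma fiber_class0 n : fiber_class n 0 = 0.
Proof.
apply/fiber_class_eq0; first exact: (ideal0 (ideal_pow_ideal I n)).
exact: (ideal0 (ideal_mul_ideal _ _)).
Qed.

Lemma fiber_class_sum n (J : Type) (s : seq J) (f : J -> A) :
  (forall j, ideal_pow I n (f j)) ->
  fiber_class n (\sum_(j <- s) f j) = \sum_(j <- s) fiber_class n (f j).
Proof.
move=> If; elim: s => [|j s IHs]; first by rewrite !big_nil fiber_class0.
by rewrite !big_cons fiber_classD ?IHs //; apply: (ideal_sum _ (ideal_pow_ideal I n)).
Qed.

Lemma fiber_class1 : fiber_class 0 1 = 1.
Proof.
rewrite -[RHS]/(to_quot _ 1); congr to_quot; apply: rees_eqP => i.
by rewrite rees_mono_coef // [RHS]coef1; case: eqP.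
Qed.

Lemma fiber_grP n f :
  fiber_gr gr I n f <-> exists2 a, ideal_pow I n a & f = fiber_class n a.
Proof.
split=> [[p p0 <-]|[a Ia ->]]; last first.
  by exists (rees_mono n a) => //= i /negPf ni; rewrite rees_mono_coef // ni.
have Ip : ideal_pow I n (rees_val p)`_n by have /asboolP := valP p; apply.
exists (rees_val p)`_n => //; congr to_quot; apply: rees_eqP => i.
by rewrite rees_mono_coef //; case: eqP => [->|/eqP/p0].
Qed.

Lemma rees_val_sum (J : Type) (s : seq J) (f : J -> rees I) i :
  (rees_val (\sum_(j <- s) f j))`_i = \sum_(j <- s) (rees_val (f j))`_i.
Proof.
elim: s => [|j s IHs]; first by rewrite !big_nil -[rees_val 0]/(0 : {poly A}) coef0.
by rewrite !big_cons -IHs -coefD.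
Qed.

Lemma to_quot_sum (S : comPzRingType) (K : set S) (J : Type) (s : seq J) (f : J -> S) :
  to_quot K (\sum_(j <- s) f j) = \sum_(j <- s) to_quot K (f j).
Proof. exact: (big_morph _ (@to_quotD _ K) (to_quot0 K)). Qed.

Lemma fiber_grading : grading (fiber_gr gr I).
Proof.
have II := ideal_pow_ideal I; split.
- by move=> n; apply/fiber_grP; exists 0; [exact: (ideal0 (II n)) | rewrite fiber_class0].
- move=> n f g /fiber_grP[a Ia ->] /fiber_grP[b Ib ->]; apply/fiber_grP.
  by exists (a - b); [exact: (idealB (II n)) | rewrite fiber_classB].
- by apply/fiber_grP; exists 1 => //; rewrite fiber_class1.
- move=> m n f g /fiber_grP[a Ia ->] /fiber_grP[b Ib ->]; apply/fiber_grP.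
  by exists (a * b); [exact: ideal_mul_closed | rewrite fiber_classM].
- move=> f; have [p ->] := to_quot_surj f.
  have Ip i : ideal_pow I i (rees_val p)`_i by have /asboolP := valP p; apply.
  exists (size (rees_val p)), (fun i => fiber_class i (rees_val p)`_i).
  split=> [i|]; first by apply/fiber_grP; exists (rees_val p)`_i.
  rewrite -to_quot_sum; congr to_quot; apply: rees_eqP => i; rewrite rees_val_sum.
  have [ip|pi] := ltnP i (size (rees_val p)).
    rewrite (bigD1 (Ordinal ip)) //= rees_mono_coef // eqxx big1 ?addr0 // => j.
    by rewrite -(inj_eq val_inj) rees_mono_coef //= eq_sym => /negPf ->.
  rewrite nth_default // big1 // => j _; rewrite rees_mono_coef //.
  by case: eqP pi => // ->; rewrite leqNgt ltn_ord.
move=> n u /(_ _)/fiber_grP/cid2-/all_sig2[a Ia uE].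
under eq_bigr => i _ do rewrite uE.
rewrite -to_quot_sum => /to_fiber_eq0 H i ilt; rewrite uE.
apply/fiber_class_eq0 => //; have := H i.
rewrite rees_val_sum (bigD1 (Ordinal ilt)) //= rees_mono_coef // eqxx big1 ?addr0 // => j.
by rewrite -(inj_eq val_inj) rees_mono_coef //= eq_sym => /negPf ->.
Qed.

End ReesClasses.

(** * The fiber ring of an ideal generated in one degree *)

Section FiberOfEquigenerated.
Variables (k : fieldType) (A : comAlgType k) (gr : nat -> set A).
Hypothesis grP : grading gr.
Hypothesis gr0E : gr 0%N = [set c%:A | c in [set: k]].
Variables (d q : nat) (h : 'I_q -> A).
Hypothesis d_gt0 : (0 < d)%N.
Hypothesis gh : forall j, gr d (h j).

Let I : set A := ideal_gen (range h).
Notation FP := (fiber_grading gr I).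
Notation mI n := (ideal_mul (irrelevant_ideal gr) (ideal_pow I n)).
Notation E := (fiber_piece gr d h).
Notation cls := (@fiber_class A gr I).

(** [I ^ n] is generated in degree [n d], so that in greater degrees coefficients
    of positive degree are needed. *)
Lemma equigen_pow_high n i a : ideal_pow I n a -> gr i a -> (n * d < i)%N -> mI n a.
Proof.
elim: n i a => [|n IHn] i a Ia ga ndi.
  rewrite -[a]mulr1; apply: ideal_mulP => //.
  by apply: sub_ideal_gen; exists i => //=; rewrite mul0n in ndi.
have [b [Ib gb ->]] :=
  ideal_mul_range_hom (e := fun=> d) gh (equigen_pow_homogeneous grP gh n) ga Ia.
apply: (ideal_sum _ (ideal_mul_ideal _ _)) => j di.
have : mI n (b j) by apply: (IHn (i - d)%N) => //; [exact: gb | lia].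
move: (b j); apply: (@ideal_mul_min _ _ _ [set c | mI n.+1 (h j * c)]).
  split=> [|c c' /= mc mc'|c c' /= mc].
  - by rewrite /= mulr0; apply: (ideal0 (ideal_mul_ideal _ _)).
  - by rewrite mulrDr; apply: (idealD (ideal_mul_ideal _ _)).
  by rewrite mulrCA; apply: (idealM _ (ideal_mul_ideal _ _)).
move=> c c' mc Ic' /=; rewrite mulrCA; apply: ideal_mulP => //.
by apply: ideal_mulP => //; apply: sub_ideal_gen; exists j.
Qed.

Lemma equigen_pow_order n : ideal_pow I n `<=` order_ge grP (n * d).
Proof. by move=> a Ia j; apply: (equigen_pow_low grP d_gt0 gh Ia). Qed.

Lemma fiber_piece_pow n a : E n a -> ideal_pow I n a.
Proof. by case. Qed.

(** [m I ^ n] lives in degrees greater than [n d]. *)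
Lemma fiber_piece_class_eq0 n a : E n a -> cls n a = 0 -> a = 0.
Proof.
move=> [Ia ga] /(fiber_class_eq0 gr Ia) mIa.
have /(_ (n * d)%N) : order_ge grP (1 + n * d) a.
  move: a mIa {Ia ga}; apply: ideal_mul_min; first exact: order_ge_ideal.
  move=> b c mb Ic; apply: order_ge_mul; first exact: irrelevant_order.
  exact: equigen_pow_order.
by rewrite (hcomp_hom grP _ ga) eqxx; apply; rewrite add1n.
Qed.

Lemma fiber_gr_piece n f : fiber_gr gr I n f <-> exists2 a, E n a & f = cls n a.
Proof.
split=> [/fiber_grP[a Ia ->]|[a [Ia _] ->]]; last by apply/fiber_grP; exists a.
have hI := equigen_pow_homogeneous grP gh n; have iI := hI.1.
have Id := hI.2 a Ia (n * d)%N.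
exists (hcomp grP a (n * d)); first by split=> //; apply: hcomp_gr.
apply/eqP; rewrite -subr_eq0 -fiber_classB //; apply/eqP/fiber_class_eq0.
  exact: (idealB iI).
have [_ [N [aN aE]]] := hcompP grP a.
pose M := maxn N (n * d).+1.
have ltM : (n * d < M)%N by rewrite leq_max ltnSn orbT.
rewrite {1}aE -(sum_widen (leq_maxl N (n * d).+1) aN) -/M.
rewrite (bigD1 (Ordinal ltM)) //= addrAC subrr add0r.
apply: (ideal_sum _ (ideal_mul_ideal _ _)) => j; rewrite -(inj_eq val_inj) /= => jn.
have [jlt|jgt|je] := ltngtP j (n * d)%N.
- rewrite (equigen_pow_low grP d_gt0 gh Ia jlt); exact: (ideal0 (ideal_mul_ideal _ _)).
- by apply: (equigen_pow_high _ (hcomp_gr grP a j)) => //; apply: hI.2.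
by rewrite je eqxx in jn.
Qed.

Lemma fiber_piece_classM m n a b : E m a -> E n b -> cls m a * cls n b = cls (m + n) (a * b).
Proof. by move=> [Ia _] [Ib _]; apply: fiber_classM. Qed.

Lemma fiber_piece_gen j : E 1 (h j).
Proof.
split; last by rewrite mul1n.
by rewrite /= -[h j]mulr1; apply: ideal_mulP => //; apply: sub_ideal_gen; exists j.
Qed.

Lemma fiber_pieceB n a b : E n a -> E n b -> E n (a - b).
Proof.
move=> [Ia ga] [Ib gb]; split; last exact: (grB grP).
exact: (idealB (ideal_pow_ideal I n)).
Qed.

Lemma fiber_irrelevant_gen :
  ideal_gen (range (fun j => cls 1 (h j))) = irrelevant_ideal (fiber_gr gr I).
Proof.
have iG := ideal_gen_ideal (range (fun j => cls 1 (h j))).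
apply/seteqP; split.
  apply: ideal_genS => _ [j _ <-]; exists 1%N => //.
  by apply/fiber_gr_piece; exists (h j) => //; apply: fiber_piece_gen.
apply: ideal_gen_min => // f [[//|n] _ /fiber_gr_piece[a Ea ->]].
have [b [Eb ->]] := fiber_pieceS grP gh Ea.
rewrite fiber_class_sum => [|j]; last first.
  by have := ideal_mul_closed (fiber_piece_pow (fiber_piece_gen j)) (fiber_piece_pow (Eb j)).
apply: (ideal_sum _ iG) => j _.
rewrite -[n.+1]/(1 + n)%N -fiber_piece_classM //; last exact: fiber_piece_gen.
by rewrite mulrC; apply: (idealM _ iG); apply: sub_ideal_gen; exists j.
Qed.

Lemma fiber_piece_generates n : ideal_pow I n `<=` ideal_gen (E n).
Proof.
elim: n => [|n IHn] a.
  move=> _; rewrite -[a]mulr1; apply: (idealM _ (ideal_gen_ideal _)).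
  by apply: sub_ideal_gen; split=> //; rewrite mul0n; apply: (gr1 grP).
move=> /(ideal_mul_rangeP (ideal_pow_ideal I n))[b [Ib ->]].
apply: (ideal_sum _ (ideal_gen_ideal _)) => j _.
move: (b j) (IHn _ (Ib j)); apply: (@ideal_gen_min _ _ [set c | ideal_gen (E n.+1) (h j * c)]).
  split=> [|c c' /= mc mc'|c c' /= mc].
  - by rewrite /= mulr0; apply: (ideal0 (ideal_gen_ideal _)).
  - by rewrite mulrDr; apply: (idealD (ideal_gen_ideal _)).
  by rewrite mulrCA; apply: (idealM _ (ideal_gen_ideal _)).
move=> c Ec /=; apply: sub_ideal_gen; exact: (fiber_pieceM grP (fiber_piece_gen j) Ec).
Qed.

Variables (s : nat) (x : nat -> A).
Hypothesis xI : forall i, I (x i).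
Hypothesis gx : forall i, exists e, gr e (x i).

Notation before := (before x).

(** The forms [x_i] of degree greater than [d] vanish in the fiber ring; only
    those of degree [d] enter the filter-regular sequence of [F(I)]. *)
Definition degree_d i : bool := `[< gr d (x i) >].

Notation Q := (partial_ideal (fun i => cls 1 (x i)) degree_d).

Lemma fiber_piece_x i : degree_d i -> E 1 (x i).
Proof.
move=> /asboolP gi; split; last by rewrite mul1n.
by rewrite /= -[x i]mulr1; apply: ideal_mulP; first exact: xI.
Qed.

Lemma fiber_gr1_x i : degree_d i -> fiber_gr gr I 1 (cls 1 (x i)).
Proof. by move=> gi; apply/fiber_gr_piece; exists (x i) => //; apply: fiber_piece_x. Qed.

(** Compare components of degree [(m + 1) d]. If [x i] has degree greater than [d], then
    its cofactor has degree less than [m d] and vanishes, being in [I ^ m]. *)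
Lemma before_S_split i m a : E m.+1 a ->
  ideal_mul (before i.+1) (ideal_pow I m) a ->
  if degree_d i
  then exists2 b, E m b & ideal_mul (before i) (ideal_pow I m) (a - x i * b)
  else ideal_mul (before i) (ideal_pow I m) a.
Proof.
move=> [Ia ga]; have hI := equigen_pow_homogeneous grP gh m.
move=> /(ideal_mul_rangeP hI.1)[b [Ib]]; rewrite big_ord_recr /=.
set a0 := (X in X + _); set b0 := b ord_max => aE.
have K0 : ideal_mul (before i) (ideal_pow I m) a0.
  apply: (ideal_sum _ (ideal_mul_ideal _ _)) => j _; apply: ideal_mulP => //.
  by apply: before_mem; apply: ltn_ord.
have hK := homogeneous_mul (before_homogeneous grP gx i) hI.
have [e ge] := gx i.
have := congr1 (fun a => hcomp grP a (m.+1 * d)) aE.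
rewrite (hcomp_hom grP _ ga) eqxx hcompD => aD.
have Ka0 := hK.2 _ K0 (m.+1 * d)%N.
case: ifPn => [/asboolP gi|/asboolP ngi].
  exists (hcomp grP b0 (m * d)).
    by split; [apply: (hI.2 _ (Ib ord_max)) | apply: hcomp_gr].
  rewrite aD (hcompM grP _ _ gi) mulSn leq_addr addKn -mulSn addrK; exact: Ka0.
have ed : (d < e)%N.
  rewrite ltn_neqAle; apply/andP; split.
    by apply: contra_notN ngi => /eqP ->.
  rewrite leqNgt; apply: contra_notN ngi => ed.
  have I1 : ideal_pow I 1 (x i) by rewrite /= -[x i]mulr1; apply: ideal_mulP; first exact: xI.
  have := equigen_pow_low grP d_gt0 gh I1 (j := e); rewrite mul1n (hcomp_hom grP _ ge) eqxx.
  by move=> -> //; apply: gr_zero.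
rewrite aD (hcompM grP _ _ ge); case: ifP => ele; last by rewrite addr0.
rewrite (equigen_pow_low grP d_gt0 gh (Ib ord_max)) ?mulr0 ?addr0 //; lia.
Qed.

(** The trace on [E n] of the ideal of the fiber ring generated by the classes of the
    [x j] of degree [d] with [j < i], as the next lemma shows. *)
Definition lifted_partial i n a : Prop :=
  if n is m.+1 then ideal_mul (before i) (ideal_pow I m) a else a = 0.

Lemma partial_ideal_lift i n a : E n a -> Q i (cls n a) <-> lifted_partial i n a.
Proof.
elim: i n a => [|i IHi] n a Ea.
  split=> [/(fiber_piece_class_eq0 Ea) ->|]; first by case: n {Ea} => // m; exact: (ideal0 (ideal_mul_ideal _ _)).
  case: n Ea => [|m] Ea /=; first by move=> ->; apply: fiber_class0.
  move=> /(ideal_mul_rangeP (ideal_pow_ideal I m))[b [_ ->]].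
  by rewrite big_ord0; apply: fiber_class0.
have sub_mul m c : ideal_mul (before i) (ideal_pow I m) c ->
    ideal_mul (before i.+1) (ideal_pow I m) c.
  exact: (ideal_mulS (before_sub (leqnSn i)) (@subset_refl _ _)).
have hQ := partial_ideal_homogeneous FP fiber_gr1_x i.
rewrite /=; case: ifPn => gi; last first.
  rewrite (IHi _ _ Ea); case: n Ea => //= m Ea; split=> [|H]; first exact: sub_mul.
  by have := before_S_split Ea H; rewrite (negPf gi).
split; last first.
  case: n Ea => [|m] Ea /= H; first by apply: sub_add_principal; apply/(IHi 0%N).
  have := before_S_split Ea H; rewrite gi => -[b Eb Hb].
  exists (cls m b); rewrite (fiber_piece_classM (fiber_piece_x gi) Eb) -fiber_classB.
  - by apply/(IHi m.+1) => //; apply: fiber_pieceB => //; apply: (fiber_pieceM grP (fiber_piece_x gi) Eb).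
  - exact: fiber_piece_pow.
  exact: (fiber_piece_pow (fiber_pieceM grP (fiber_piece_x gi) Eb)).
have gF : gr_int (fiber_gr gr I) n%:Z (cls n a) by apply/fiber_gr_piece; exists a.
move=> /(add_principal_int hQ (fiber_gr1_x gi) gF)[f].
case: n Ea gF => [|m] Ea gF.
  by move=> /= ->; rewrite mulr0 subr0 => /(IHi _ _ Ea).
rewrite intS addrC addKr => /fiber_gr_piece[b Eb ->].
have Exb := fiber_pieceM grP (fiber_piece_x gi) Eb.
rewrite (fiber_piece_classM (fiber_piece_x gi) Eb) -fiber_classB; [|exact: fiber_piece_pow|exact: (fiber_piece_pow Exb)].
move=> /(IHi m.+1 _ (fiber_pieceB Ea Exb)) /= Hab.
rewrite -(subrK (x i * b) a); apply: (idealD (ideal_mul_ideal _ _)); first exact: sub_mul.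
by apply: ideal_mulP; [apply: before_mem | exact: fiber_piece_pow].
Qed.

Variable rJ : nat.
Hypothesis rJP : is_reduction_number (before s) I rJ.

Lemma reduction_mono n m : (n <= m)%N ->
  ideal_pow I n.+1 = ideal_mul (before s) (ideal_pow I n) ->
  ideal_pow I m.+1 = ideal_mul (before s) (ideal_pow I m).
Proof.
move=> nm redn; rewrite -(subnK nm); elim: (m - n)%N => [|l IHl] //.
rewrite addSn; set N := (l + n)%N in IHl *.
apply/seteqP; split; last by apply: ideal_mulS => //; apply: before_subI.
apply: ideal_mul_min; first exact: ideal_mul_ideal.
move=> a b Ia Ib; have {Ib} : ideal_mul (before s) (ideal_pow I N) b by rewrite -IHl.
move: b; apply: (@ideal_mul_min _ _ _
  [set b | ideal_mul (before s) (ideal_pow I N.+1) (a * b)]).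
  split=> [|c c' /= mc mc'|c c' /= mc].
  - by rewrite /= mulr0; apply: (ideal0 (ideal_mul_ideal _ _)).
  - by rewrite mulrDr; apply: (idealD (ideal_mul_ideal _ _)).
  by rewrite mulrCA; apply: (idealM _ (ideal_mul_ideal _ _)).
by move=> b c bb Ic /=; rewrite mulrCA; apply: ideal_mulP => //; apply: ideal_mulP.
Qed.

Lemma reduction_number_le t : (rJ <= t)%N <->
  forall n, (t <= n)%N -> E n.+1 `<=` ideal_mul (before s) (ideal_pow I n).
Proof.
have [red rmin] := rJP; split=> [rt n tn a [Ia _]|H].
  by rewrite -(reduction_mono (leq_trans rt tn) red).
apply: rmin; apply/seteqP; split.
  apply: subset_trans (@fiber_piece_generates t.+1) _; apply: ideal_gen_min.
    exact: ideal_mul_ideal.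
  exact: H.
by apply: ideal_mulS => //; apply: before_subI.
Qed.

(** The condition of the theorem, with the inclusion that always holds left out. *)
Definition colon_condition t : Prop := (rJ <= t)%N /\
  forall n i, (t <= n)%N -> (i < s)%N -> forall a, E n.+1 a ->
    before i (a * x i) -> ideal_mul (before i) (ideal_pow I n) a.

Notation regF t := (regular_from (fiber_gr gr I) (fun i => cls 1 (x i)) degree_d s t).

(** If the product of [a] and [x i] is in [(x_0, ..., x_(i-1)) I ^ (n + 1)], it is in
    [(x_0, ..., x_(i-1))]. *)
Lemma colon_condition_regular t : colon_condition t -> regF t.+1.
Proof.
move=> [/reduction_number_le rt col]; split=> [[//|n] tn f /fiber_gr_piece[a Ea ->]|].
  by apply/(partial_ideal_lift _ Ea); apply: rt.
move=> i si gi [//|n] tn f /fiber_gr_piece[a Ea ->]; rewrite (fiber_piece_classM (fiber_piece_x gi) Ea).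
move=> /(partial_ideal_lift _ (fiber_pieceM grP (fiber_piece_x gi) Ea)) /= H.
apply/(partial_ideal_lift _ Ea); apply: col => //.
by rewrite mulrC; apply: ideal_mul_subl H; apply: before_ideal.
Qed.

(** Regularity in the fiber ring speaks of [a * x j] in [(x_0, ..., x_(j-1)) I ^ (n+1)], the
    colon condition of [a * x i] in [(x_0, ..., x_(i-1))] only. In high degrees the colon
    condition holds. To descend from degree [n + 1] to [n], multiply [a] by the [x j] of
    degree [d] with [j >= i]: the colon condition applies to the products, and
    regularity removes the factors, starting from [a] in [before s * I ^ n]. *)
Lemma regular_colon_condition t N : colon_condition N -> regF t.+1 -> colon_condition t.
Proof.
move=> [_ colN] [Qs Qreg].
have red : forall n, (t <= n)%N -> E n.+1 `<=` ideal_mul (before s) (ideal_pow I n).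
  move=> n tn a Ea; apply/(partial_ideal_lift s Ea); apply: (Qs n.+1) => //.
  by apply/fiber_gr_piece; exists a.
split; first exact/reduction_number_le.
(* [l] bounds the distance from [n] to [N]. *)
suff H l : forall n i, (N <= n + l)%N -> (t <= n)%N -> (i < s)%N -> forall a, E n.+1 a ->
    before i (a * x i) -> ideal_mul (before i) (ideal_pow I n) a.
  by move=> n i; apply: (H N); rewrite leq_addl.
elim: l => [|l IHl] n i Nn tn si a Ea bax.
  by apply: colN => //; rewrite addn0 in Nn.
(* [before s] shrinks to [before i], one form at a time. *)
suff H m : (m <= s - i)%N -> ideal_mul (before (s - m)) (ideal_pow I n) a.
  by have := H (s - i)%N (leqnn _); rewrite subKn // ltnW.
elim: m => [|m IHm] ms; first by rewrite subn0; apply: red.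
set j := (s - m.+1)%N; have jE : (s - m)%N = j.+1 by rewrite /j; lia.
have ij : (i <= j)%N by rewrite /j; lia.
have js : (j < s)%N by rewrite /j; lia.
have := IHm (ltnW ms); rewrite jE => /(before_S_split Ea).
case: ifPn => gj; last by [].
move=> _; apply/(partial_ideal_lift j Ea); apply: (Qreg j js gj n.+1) => //.
  by apply/fiber_gr_piece; exists a.
have Exa := fiber_pieceM grP (fiber_piece_x gj) Ea.
rewrite (fiber_piece_classM (fiber_piece_x gj) Ea); apply/(partial_ideal_lift j Exa) => /=.
apply: (ideal_mulS (before_sub ij) (@subset_refl _ _)).
have [Nn1 tn1] : (N <= n.+1 + l)%N /\ (t <= n.+1)%N by lia.
apply: (IHl n.+1 i Nn1 tn1 si _ Exa).
by rewrite -mulrA; apply: (idealM _ (before_ideal x i)).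
Qed.

Hypothesis sup : forall i, (i < s)%N -> exists c N, forall n, (N <= n)%N ->
  forall b w, ideal_pow I c b -> ideal_pow I n.+1 w -> before i (b * x i - w) ->
  exists2 w', ideal_pow I n w' & before i (b - w').

Lemma colon_condition_large : exists N, colon_condition N.
Proof.
have [N NP] : exists N, forall i : 'I_s, forall n, (N <= n)%N -> forall a, E n.+1 a ->
    before i (a * x i) -> ideal_mul (before i) (ideal_pow I n) a.
  apply: uniform_bound => [i c c' cc' H n cn|i]; first by apply: H; apply: leq_trans cn.
  exact: (colon_large grP gr0E d_gt0 gh xI gx sup (ltn_ord i)).
exists (maxn N rJ); split; first exact: leq_maxr.
move=> n i nN si; apply: (NP (Ordinal si)); apply: leq_trans nN; exact: leq_maxl.
Qed.

Lemma reg_fiber_ring : exists t, is_least colon_condition t /\ is_reg (fiber_gr gr I) t%:Z.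
Proof.
have [N cN] := colon_condition_large.
have [|t /asboolP ct tmin] := @ex_minnP (fun t => `[< colon_condition t >]).
  by exists N; apply/asboolP.
have least : is_least colon_condition t.
  by split=> // n cn; apply: tmin; apply/asboolP.
exists t; split=> //.
apply: (@reg_filter_regular _ _ (fun i => cls 1 (x i)) degree_d FP fiber_gr1_x s).
- exists q, (fun j => cls 1 (h j)); split; last exact: fiber_irrelevant_gen.
  by move=> j; apply/fiber_gr_piece; exists (h j) => //; apply: fiber_piece_gen.
- have E1 : E 0 1 by split=> //; rewrite mul0n; apply: (gr1 grP).
  rewrite -(fiber_class1 gr I) => /(partial_ideal_lift _ E1) /= /eqP.
  by rewrite oner_eq0.
split; first exact: colon_condition_regular.
by move=> n /(regular_colon_condition cN)/least.2.
Qed.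

End FiberOfEquigenerated.

(** * The regularity of the fiber ring *)

Section NatIndexing.
Variables (R : comPzRingType) (s : nat) (x : 'I_s -> R).

(** Recursions on the number of forms need an index that is not bounded by [s]. *)
Definition extend0 (i : nat) : R := if insub i is Some j then x j else 0.

Lemma extend0E (j : 'I_s) : extend0 j = x j.
Proof. by rewrite /extend0 valK. Qed.

Lemma extend0_ind (P : R -> Prop) : P 0 -> (forall j, P (x j)) -> forall i, P (extend0 i).
Proof. by move=> P0 Px i; rewrite /extend0; case: insubP. Qed.

End NatIndexing.

Lemma before_extend0 (k : fieldType) (A : comAlgType k) s (x : 'I_s -> A) (i : 'I_s) :
  before (extend0 x) i = ideal_before x i.
Proof.
congr ideal_gen; apply/seteqP; split=> [_ [j _ <-]|_ [j /= ji <-]].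
  have js : (j < s)%N := ltn_trans (ltn_ord j) (ltn_ord i).
  by exists (Ordinal js); [exact: (ltn_ord j) | rewrite -extend0E].
by exists (Ordinal ji) => //; rewrite -extend0E.
Qed.

Lemma before_extend0_full (k : fieldType) (A : comAlgType k) s (x : 'I_s -> A) :
  before (extend0 x) s = ideal_gen (range x).
Proof.
by congr ideal_gen; apply/seteqP; split=> _ [j _ <-]; exists j; rewrite ?extend0E.
Qed.

Theorem theorem3p2 (k : fieldType) (A : comAlgType k) (gr : nat -> set A)
  (hA : standard_graded gr) (hdim : krull_dim_ge A 1)
  (d : nat) (hd : (1 <= d)%N) (I : set A)
  (hI : exists G : set A, G `<=` gr d /\ I = ideal_gen G)
  (s : nat) (x : 'I_s -> A)
  (hx : superficial_seq I x) (hxhom : forall i, exists e, gr e (x i))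
  (hJ : is_reduction (ideal_gen (range x)) I)
  (rJ : nat) (hrJ : is_reduction_number (ideal_gen (range x)) I rJ) :
  exists t : nat,
    is_least (fun t => (rJ <= t)%N /\
      forall (n : nat) (i : 'I_s), (t <= n)%N ->
        (ideal_pow I n.+1 `&` ideal_colon (ideal_before x i) (x i))
          `&` gr (n.+1 * d)%N
        = ideal_mul (ideal_before x i) (ideal_pow I n) `&` gr (n.+1 * d)%N) t
    /\ is_reg (fiber_gr gr I) t%:Z.
Proof.
have nA := standard_graded_noetherian hA.
have [grP gr0E _] := hA; have [G [Gd IG]] := hI.
have [q [h [Gh GhE]]] := ideal_gen_finite G nA.
have gh j : gr d (h j) by apply: Gd.
rewrite {}GhE in IG; subst I.
pose X := extend0 x.
have XI i : ideal_gen (range h) (X i).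
  apply: (@extend0_ind _ _ x (ideal_gen (range h))) => [|j].
    exact: (ideal0 (ideal_gen_ideal _)).
  by have [] := hx j.
have gX i : exists e, gr e (X i).
  apply: (@extend0_ind _ _ x (fun a => exists e, gr e a)) => //.
  by exists 0%N; apply: (gr0 grP).
have sup i : (i < s)%N -> exists c N, forall n, (N <= n)%N ->
    forall b w, ideal_pow (ideal_gen (range h)) c b ->
    ideal_pow (ideal_gen (range h)) n.+1 w -> before X i (b * X i - w) ->
    exists2 w', ideal_pow (ideal_gen (range h)) n w' & before X i (b - w').
  move=> si; have [_] := hx (Ordinal si); rewrite -before_extend0 -extend0E.
  exact/superficial_lift/before_ideal.
rewrite -before_extend0_full in hrJ.
have [t [[ct tmin] regt]] := reg_fiber_ring grP gr0E hd gh XI gX hrJ sup.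
have condE t' : colon_condition gr d h s X rJ t' <-> ((rJ <= t')%N /\
    forall (n : nat) (i : 'I_s), (t' <= n)%N ->
      (ideal_pow (ideal_gen (range h)) n.+1 `&` ideal_colon (ideal_before x i) (x i))
          `&` gr (n.+1 * d)%N
      = ideal_mul (ideal_before x i) (ideal_pow (ideal_gen (range h)) n)
          `&` gr (n.+1 * d)%N).
  split=> -[rt H]; split=> // n i tn.
    rewrite -before_extend0 -extend0E; apply/seteqP; split=> a.
      by move=> [[Ia ca] ga]; split=> //; apply: H.
    move=> [Ka ga]; do 2?split=> //.
      by apply: ideal_mulS Ka => //; apply: before_subI.
    rewrite /ideal_colon /= mulrC; apply: (idealM _ (before_ideal X i)).
    by apply: ideal_mul_subl Ka; apply: before_ideal.
  move=> si a [Ia ga] ba.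
  have := H n (Ordinal si) tn; rewrite -before_extend0 -extend0E => /seteqP[+ _].
  by move=> /(_ a)[].
exists t; split=> //; split; first exact/condE.
by move=> n /condE; apply: tmin.
Qed.
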